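(* Let $\Delta$ be the strongly regular graph with parameters $(105,32,4,12)$ and let $(\hat\Delta,\hat\theta)$ be the distance-regular triple cover of $\Delta$ (the unique distance-regular graph with intersection array $\{32,27,8,1;1,4,27,32\}$, regarded as a 3-cover of $\Delta$). There is no distance-regular antipodal $6$-cover of $\Delta$ of the form $(\Gamma,\theta\hat\theta)$ where $(\Gamma,\theta)$ is a double cover of $\hat\Delta$.
   Context: A cover of a graph $\Gamma$ is a pair $(\tilde\Gamma,\theta)$ with $\theta:V(\tilde\Gamma)\to V(\Gamma)$ surjective such that: each fibre $v\theta^{-1}$ is a coclique; the union of two distinct fibres over a non-edge of $\Gamma$ is a coclique; the subgraph induced on two fibres over an edge is a perfect matching; the subgraph induced on three fibres over a triangle is a disjoint union of triangles. It is an $r$-cover (double cover for $r=2$, triple cover for $r=3$) if all fibres have size $r$. For non-complete $\Gamma$, an antipodal $r$-cover is a connected $r$-cover $\tilde\Gamma$ in which ''equal or at maximum distance'' is an equivalence relation on $V(\tilde\Gamma)$ whose classes are the fibres. A composite of a cover of a cover is a cover. $\Delta$ is unique up to isomorphism, and up to isomorphism of covers $\Delta$ has exactly one distance-regular triple cover $\hat\Delta$. *)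

(* Defs.v *)
From HB Require Import structures.
From mathcomp Require Import all_boot.
Set Implicit Arguments. Unset Strict Implicit. Unset Printing Implicit Defensive.

Section Graphs.
Variable T : finType.
Variable e : rel T.

Definition simple_graph : Prop := symmetric e /\ irreflexive e.

Fixpoint ball (n : nat) (x : T) : {set T} :=
  match n with
  | 0 => [set x]
  | n'.+1 => ball n' x :|: [set y | [exists z in ball n' x, e z y]]
  end.

(* graph distance; equals #|T| when y is unreachable from x (never happens in a connected graph) *)
Definition dist (x y : T) : nat := find (fun n => y \in ball n x) (iota 0 #|T|).

Definition connected : Prop := forall x y : T, connect e x y.

Definition diameter : nat := \max_(x : T) \max_(y : T) dist x y.

Definition distance_regular : Prop :=
  connected /\
  exists b c : nat -> nat, forall x y : T,
    (#|[set z | e y z & dist x z == (dist x y).+1]| = b (dist x y)) /\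
    (1 <= dist x y -> #|[set z | e y z & dist x z == (dist x y).-1]| = c (dist x y)).

Definition srg (v k lam mu : nat) : Prop :=
  #|T| = v /\
  (forall x, #|[set y | e x y]| = k) /\
  (forall x y, e x y -> #|[set z | e x z & e y z]| = lam) /\
  (forall x y, x != y -> ~~ e x y -> #|[set z | e x z & e y z]| = mu).

Definition disjoint_union_of_triangles (S : {set T}) : Prop :=
  exists P : {set {set T}},
    partition P S /\
    (forall B, B \in P -> #|B| = 3 /\ (forall x y, x \in B -> y \in B -> x != y -> e x y)) /\
    (forall x y, x \in S -> y \in S -> e x y -> pblock P x = pblock P y).

End Graphs.

Definition fibre (T' T : finType) (th : T' -> T) (v : T) : {set T'} := [set x | th x == v].

Definition is_cover (T' T : finType) (e' : rel T') (e : rel T) (th : T' -> T) : Prop :=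
  (forall v : T, exists x : T', th x = v) /\
  (forall v : T, forall x y, x \in fibre th v -> y \in fibre th v -> ~~ e' x y) /\
  (forall u v : T, u != v -> ~~ e u v ->
     forall x y, x \in fibre th u :|: fibre th v -> y \in fibre th u :|: fibre th v -> ~~ e' x y) /\
  (forall u v : T, e u v -> forall x, x \in fibre th u :|: fibre th v ->
     #|[set y in fibre th u :|: fibre th v | e' x y]| = 1) /\
  (forall u v w : T, e u v -> e v w -> e u w ->
     disjoint_union_of_triangles e' (fibre th u :|: fibre th v :|: fibre th w)).

Definition r_cover (T' T : finType) (e' : rel T') (e : rel T) (th : T' -> T) (r : nat) : Prop :=
  is_cover e' e th /\ forall v : T, #|fibre th v| = r.

Definition antipodal_r_cover (T' T : finType) (e' : rel T') (e : rel T) (th : T' -> T) (r : nat) : Prop :=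
  r_cover e' e th r /\ connected e' /\
  forall x y : T', ((x == y) || (dist e' x y == diameter e')) = (th x == th y).

(* Main.v *)
Require Import Defs.
From mathcomp Require Import all_boot all_order all_algebra.
From mathcomp Require Import zify ring lra.
Import Order.TTheory GRing.Theory Num.Theory.

(** The adjacency matrix A of Delta satisfies A^2 = 20 - 8A + 12J, and an integer vector R
    with A R = 12 - 10 R and |R|^2 = 36 must be a row of A - 2I.  Hence a short integer
    combination of rows of A - 2I with the right weight and norm is again such a row, and
    vertices of Delta can be produced from a few given ones.

    In an antipodal distance-regular 6-cover Gamma of Delta, two vertices over distinct
    nonadjacent vertices have exactly 2 common neighbours: the 12 common neighbours of the
    projections are spread evenly over the 6 vertices of a fibre.  Consequently the graph
    induced on the neighbourhood N(x) of a vertex x of Delta has no 4-cycle; it is then the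
    incidence graph of the 16 points and 16 nonvertical lines of the affine plane over F_4,
    and each of its 64 edges determines a further vertex at distance 2 from x.  This gives an
    explicit subgraph of Delta on 97 vertices.

    Fix a vertex u of Gamma over x and a triangle y1, y2, y3 at distance 2 from x.  The 12
    common neighbours of x and yi, lifted to neighbours of u, are joined in pairs to the 6
    vertices over yi; there are 6 possible pairings for each i.  The perfect matchings between
    the fibres over the yi must respect these pairings, and must not create a 4-cycle in which
    two opposite vertices have three common neighbours.  A finite search shows that this is impossible. *)

(** * Integer vectors in the -10 eigenspace *)

(** Since (A - 2I)^2 = 12(2I - A + J), the norm of a combination of rows depends only on the
    adjacencies among the few vertices used, so it can be computed before anything else about
    $\Delta$ is known. A row has norm 36, while the -10 eigenspace contains no integer vector of
    norm 24; this gap is what forces a suitable vector of norm 36 to be a row.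

    The even spreading over the fibres of $\Gamma$ is the delicate point. The hypotheses do not
    state that the diameter is 4, so a vertex over a nonadjacent fibre might a priori have no common
    neighbour with u. Connectedness yields a vertex at distance 2 from two vertices of one fibre,
    hence diameter 4, and distance-regularity then makes every such distance equal to 2.

    The norm argument excludes triangles and 5-cycles in a neighbourhood; without 4-cycles it has
    girth at least 6, and counting around one vertex determines it. In the search only the matchings
    from the first fibre to the other two are chosen: the triangle axiom fixes the third. *)

Section Eigenvectors.
Set Implicit Arguments. Unset Strict Implicit. Unset Printing Implicit Defensive.
Local Open Scope ring_scope.

Variables (V : finType) (e : rel V).
Hypotheses (simple_e : simple_graph e) (srg_e : srg e 105 32 4 12).

Lemma e_sym x y : e x y = e y x.
Proof. by case: simple_e => s _; rewrite s. Qed.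

Lemma e_irr x : e x x = false.
Proof. by case: simple_e => _ s; rewrite s. Qed.

Definition adj x y : int := (e x y)%:R.
Definition delta x y : int := (x == y :> V)%:R.
Definition nbsum (f : V -> int) x : int := \sum_y adj x y * f y.

Lemma adj_sym x y : adj x y = adj y x.
Proof. by rewrite /adj e_sym. Qed.

Lemma delta_sym x y : delta x y = delta y x.
Proof. by rewrite /delta eq_sym. Qed.

Lemma sum_delta (f : V -> int) x : \sum_y delta x y * f y = f x.
Proof.
rewrite (bigD1 x) //= /delta eqxx mul1r big1 ?addr0 // => y yx.
by rewrite eq_sym (negbTE yx) mul0r.
Qed.

Lemma sum_bool (P : pred V) : \sum_x (P x)%:R = #|[set x | P x]|%:R :> int.
Proof.
rewrite cardsE -sum1_card natr_sum [RHS]big_mkcond /=.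
by apply: eq_bigr => x _; rewrite unfold_in; case: (P x).
Qed.

Lemma adj_sq x y : \sum_z adj x z * adj z y = 20%:R * delta x y - 8%:R * adj x y + 12%:R.
Proof.
have [_ [deg [lam mu]]] := srg_e.
have -> : \sum_z adj x z * adj z y = #|[set z | e x z & e y z]|%:R.
  rewrite -sum_bool; apply: eq_bigr => z _.
  by rewrite /adj (e_sym z y) -natrM mulnb.
rewrite /delta /adj; case: eqVneq => [->|xy] /=.
  have -> : [set z | e y z & e y z] = [set z | e y z].
    by apply/setP => z; rewrite !inE andbb.
  by rewrite deg e_irr.
have [exy|nexy] := boolP (e x y); first by rewrite lam.
by rewrite (mu x y).
Qed.

Lemma nbsum2 f x : nbsum (nbsum f) x = 20%:R * f x - 8%:R * nbsum f x + 12%:R * \sum_y f y.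
Proof.
rewrite /nbsum.
under eq_bigr => y _ do rewrite mulr_sumr.
rewrite exchange_big /=.
transitivity (\sum_z (20%:R * delta x z - 8%:R * adj x z + 12%:R) * f z).
  apply: eq_bigr => z _; rewrite -adj_sq mulr_suml.
  by apply: eq_bigr => y _; rewrite mulrA.
rewrite -[f x in RHS](sum_delta f x) !mulr_sumr -sumrB -big_split /=.
by apply: eq_bigr => z _; ring.
Qed.

Lemma sum_nbsum f : \sum_x nbsum f x = 32%:R * \sum_x f x.
Proof.
have [_ [deg _]] := srg_e.
rewrite /nbsum exchange_big mulr_sumr; apply: eq_bigr => y _.
rewrite -mulr_suml; congr (_ * _).
transitivity (\sum_x (e y x)%:R : int); first by apply: eq_bigr => x _; exact: adj_sym.
by rewrite sum_bool deg.
Qed.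

Lemma nbsum_adjoint f g : \sum_x nbsum f x * g x = \sum_x f x * nbsum g x.
Proof.
rewrite /nbsum; under eq_bigr => x _ do rewrite mulr_suml.
rewrite exchange_big; apply: eq_bigr => y _; rewrite mulr_sumr.
by apply: eq_bigr => x _; rewrite (adj_sym x y) mulrCA mulrA.
Qed.

Lemma sum_const (n : int) : \sum_(x : V) n = 105%:R * n.
Proof. by rewrite sumr_const; have [-> _] := srg_e; rewrite mulr_natl. Qed.

(** This is the identity (A - 2I)^2 = 12(2I - A + J) evaluated on [f]. *)
Lemma sum_sqr f :
  \sum_x (nbsum f x - 2%:R * f x) ^+ 2 =
  12%:R * (2%:R * (\sum_x f x ^+ 2) - \sum_x f x * nbsum f x) + 12%:R * (\sum_x f x) ^+ 2.
Proof.
have E : \sum_x nbsum f x ^+ 2 = 20%:R * (\sum_x f x ^+ 2) - 8%:R * (\sum_x f x * nbsum f x) + 12%:R * (\sum_x f x) ^+ 2.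
  transitivity (\sum_x f x * nbsum (nbsum f) x); first by rewrite -nbsum_adjoint.
  transitivity (\sum_x (20%:R * f x ^+ 2 - 8%:R * (f x * nbsum f x) + 12%:R * (\sum_y f y) * f x)).
    by apply: eq_bigr => x _; rewrite nbsum2; ring.
  by rewrite big_split sumrB /= -!mulr_sumr -mulrA -expr2.
transitivity (\sum_x (nbsum f x ^+ 2 - 4%:R * (f x * nbsum f x) + 4%:R * f x ^+ 2)).
  by apply: eq_bigr => x _; ring.
by rewrite big_split sumrB /= -!mulr_sumr E; ring.
Qed.

(* Such a k takes 12 times each of the values 1 and -1; with q x the number of neighbours of x
   in [k = 1], the contradiction comes from 0 <= the sum of (q - 3)^2 over [k = 0]. *)
Lemma no_small_eigenvector (k : V -> int) :
  (forall x, nbsum k x = - 10%:R * k x) -> \sum_x k x ^+ 2 = 24%:R -> False.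
Proof.
move=> eig sq.
have S0 : \sum_x k x = 0.
  have := sum_nbsum k.
  under eq_bigr => x _ do rewrite eig.
  rewrite -mulr_sumr; move: (\sum_i k i) => s; lia.
(* Integers satisfy |f| <= f^2 and [f] has sum 0, so 20 f(x) = -2 (sum of f over the neighbours of
   x) <= sum (|f| - f) <= sum f^2 = 24, which excludes f(x) >= 2. It is applied to [k] and to
   [- k]. *)
have bound (f : V -> int) : (forall x, nbsum f x = - 10%:R * f x) -> \sum_x f x ^+ 2 = 24%:R ->
    \sum_x f x = 0 -> forall x, f x <= 1.
  move=> eigf sqf f0 x.
  have h1 : 20%:R * f x <= \sum_y (`|f y| - f y).
    have -> : 20%:R * f x = \sum_y - 2%:R * (adj x y * f y).
      by rewrite -mulr_sumr [\sum_y _]eigf; ring.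
    apply: ler_sum => y _; rewrite /adj; case: (e x y) => /=; lia.
  have h2 : \sum_y (`|f y| - f y) <= 24%:R.
    rewrite sumrB f0 subr0 -sqf; apply: ler_sum => y _.
    by rewrite -[f y ^+ 2]real_normK ?num_real //; nia.
  lia.
have le1 := bound _ eig sq S0.
have ge1 x : - 1 <= k x.
  have := bound (fun y => - k y).
  move=> /(_ _ _ _ x); rewrite lerNl; apply => [y||].
  - rewrite /nbsum; under eq_bigr => z _ do rewrite mulrN.
    by rewrite sumrN [\sum_z _]eig; ring.
  - by rewrite -sq; apply: eq_bigr => y _; ring.
  - by rewrite sumrN S0 oppr0.
pose P x : int := (k x == 1)%:R.
pose M x : int := (k x == -1)%:R.
have kcase x : [\/ k x = 1, k x = 0 | k x = -1].
  have := le1 x; have := ge1 x => h h'.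
  have : k x = 1 \/ k x = 0 \/ k x = -1 by lia.
  by case=> [?|[?|?]]; [constructor 1|constructor 2|constructor 3].
have SP : \sum_x P x = 12%:R.
  have : \sum_x (2%:R * P x) = \sum_x (k x ^+ 2 + k x).
    by apply: eq_bigr => x _; rewrite /P; case: (kcase x) => ->.
  rewrite -mulr_sumr big_split /= sq S0; move: (\sum_i P i) => s; lia.
have SM : \sum_x M x = 12%:R.
  have : \sum_x (2%:R * M x) = \sum_x (k x ^+ 2 - k x).
    by apply: eq_bigr => x _; rewrite /M; case: (kcase x) => ->.
  rewrite -mulr_sumr sumrB /= sq S0; move: (\sum_i M i) => s; lia.
have q0 x : 0 <= nbsum P x by apply: sumr_ge0 => y _; rewrite /adj /P -natrM ler0n.
have q'0 x : 0 <= nbsum M x by apply: sumr_ge0 => y _; rewrite /adj /M -natrM ler0n.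
have qq' x : nbsum P x = nbsum M x - 10%:R * k x.
  have : nbsum P x - nbsum M x = nbsum k x.
    rewrite /nbsum -sumrB; apply: eq_bigr => y _; rewrite -mulrBr; congr (_ * _).
    by rewrite /P /M; case: (kcase y) => ->.
  by rewrite eig; lia.
pose E := \sum_x P x * nbsum P x; pose E' := \sum_x M x * nbsum M x.
have E0 : 0 <= E by apply: sumr_ge0 => x _; rewrite mulr_ge0 // /P ler0n.
have E'0 : 0 <= E' by apply: sumr_ge0 => x _; rewrite mulr_ge0 // /M ler0n.
have Sq2 : \sum_x nbsum P x ^+ 2 = 1968%:R - 8%:R * E.
  transitivity (\sum_x P x * nbsum (nbsum P) x); first by rewrite -nbsum_adjoint.
  transitivity (\sum_x (164%:R * P x - 8%:R * (P x * nbsum P x))).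
    apply: eq_bigr => x _; rewrite nbsum2 SP.
    by rewrite /P; case: (k x == 1) => /=; ring.
  by rewrite sumrB /= -!mulr_sumr SP -/E; ring.
(* On [k = 0] the values of [nbsum P] add up to at most 32 * 12 - 120 = 264 over 81 vertices, which
   suggests the shift by 3. On [k = -1] one has [nbsum P - 3 = nbsum M + 7]. Dropping the squares on
   both nonzero classes leaves terms linear in [E] and [E'], and the outcome is 87 + 2E + 14E' <=
   0. *)
have le : \sum_x (P x * (9%:R - 6%:R * nbsum P x) + M x * (49%:R + 14%:R * nbsum M x))
   <= \sum_x (nbsum P x - 3%:R) ^+ 2.
  apply: ler_sum => x _; have := q0 x; have := q'0 x; have := qq' x.
  rewrite /P /M; case: (kcase x) => -> /=; rewrite -/P -/M;
    move: (nbsum P x) (nbsum M x) => a b; nia.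
have L : \sum_x (P x * (9%:R - 6%:R * nbsum P x) + M x * (49%:R + 14%:R * nbsum M x))
   = 696%:R - 6%:R * E + 14%:R * E'.
  transitivity (\sum_x (9%:R * P x - 6%:R * (P x * nbsum P x) + (49%:R * M x + 14%:R * (M x * nbsum M x)))).
    by apply: eq_bigr => x _; ring.
  by rewrite !big_split sumrN /= -!mulr_sumr SP SM -/E -/E'; ring.
have R : \sum_x (nbsum P x - 3%:R) ^+ 2 = 609%:R - 8%:R * E.
  transitivity (\sum_x (nbsum P x ^+ 2 - 6%:R * nbsum P x + 9%:R)).
    by apply: eq_bigr => x _; ring.
  by rewrite big_split sumrB /= -!mulr_sumr Sq2 sum_nbsum SP sum_const; ring.
by move: le; rewrite L R; lia.
Qed.

(** Subtracting the row of [w] gives a vector of the -10 eigenspace of norm 48 + 24 R(w). So R >=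
    -2; the value -1 would give the impossible norm 24, and -2 gives norm 0, so that [R] is the row
    of [w]. If -2 never occurs, then R >= 0, the eigenvalue equation forces R <= 1, and a 0/1 vector
    cannot have sum 30 and norm 36. *)
Lemma vertex_row (R : V -> int) :
  (forall x, nbsum R x = 12%:R - 10%:R * R x) -> \sum_x R x ^+ 2 = 36%:R ->
  exists w, forall x, R x = adj w x - 2%:R * delta w x.
Proof.
move=> eig sq.
have S30 : \sum_x R x = 30%:R.
  have := sum_nbsum R; under eq_bigr => x _ do rewrite eig.
  by rewrite sumrB sum_const -mulr_sumr; move: (\sum_i R i) => s; lia.
pose k w x := R x - (adj w x - 2%:R * delta w x).
have row_eig w x : nbsum (fun y => adj w y - 2%:R * delta w y) x = 12%:R - 10%:R * (adj w x - 2%:R * delta w x).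
  transitivity (\sum_y (adj w y * adj y x - 2%:R * (delta w y * adj y x))).
    by apply: eq_bigr => y _; rewrite (adj_sym x y); ring.
  by rewrite sumrB -mulr_sumr adj_sq sum_delta; ring.
have k_eig w x : nbsum (k w) x = - 10%:R * k w x.
  rewrite /nbsum /k; under eq_bigr => y _ do rewrite mulrBr.
  by rewrite sumrB [\sum_y _]eig [\sum_y _]row_eig; ring.
have k_sq w : \sum_x k w x ^+ 2 = 48%:R + 24%:R * R w.
  transitivity (\sum_x (R x ^+ 2 - 2%:R * (adj w x * R x) + 4%:R * (delta w x * R x)
      + adj w x * adj x w + 4%:R * delta w x)).
    apply: eq_bigr => x _; rewrite /k (adj_sym x w) /adj /delta.
    by case: eqVneq => [<-|_]; rewrite ?e_irr /=; [ring | case: (e w x) => /=; ring].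
  rewrite !big_split sumrN /= -!mulr_sumr sq [\sum_i adj w i * R i]eig sum_delta adj_sq.
  have -> : \sum_x delta w x = 1.
    by rewrite -(sum_delta (fun=> 1) w); apply: eq_bigr => x _; rewrite mulr1.
  by rewrite /adj /delta e_irr eqxx /=; ring.
case: (pickP (fun w => R w == - 2%:R)) => [w /eqP Rw|no2].
  exists w => x; apply/eqP; rewrite -subr_eq0 -/(k w x) -sqrf_eq0.
  have : \sum_x k w x ^+ 2 == 0 by rewrite k_sq Rw.
  by rewrite psumr_eq0 => [/allP/(_ x (mem_index_enum _))|y _]; rewrite ?sqr_ge0.
exfalso.
have R_ge0 w : 0 <= R w.
  have h1 : 0 <= \sum_x k w x ^+ 2 by apply: sumr_ge0 => x _; rewrite sqr_ge0.
  have h2 : R w <> - 1.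
    by move=> Rw; apply: (no_small_eigenvector (k_eig w)); rewrite k_sq Rw.
  have h3 : R w <> - 2%:R by move/eqP; rewrite no2.
  by move: h1; rewrite k_sq; lia.
have R_le1 w : R w <= 1.
  have : 0 <= nbsum R w by apply: sumr_ge0 => x _; rewrite mulr_ge0 // /adj ler0n.
  by rewrite eig; lia.
have : \sum_x R x ^+ 2 = \sum_x R x.
  apply: eq_bigr => x _; have := R_ge0 x; have := R_le1 x; move: (R x) => r h h'.
  by have [->|->] : r = 0 \/ r = 1 by lia.
by rewrite sq S30.
Qed.

(** * Combinations of rows that are again rows *)

Definition weight (l : seq (int * V)) : int := \sum_(p <- l) p.1.
Definition rowsum (l : seq (int * V)) x : int := \sum_(p <- l) p.1 * (adj p.2 x - 2%:R * delta p.2 x).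
(** The quadratic form of 2I - A: [rowsum l] has norm 12 ([quad l] + [weight l] ^ 2). *)
Definition quad (l : seq (int * V)) : int :=
  \sum_(p <- l) \sum_(q <- l) p.1 * q.1 * (2%:R * delta p.2 q.2 - adj p.2 q.2).

Section Combination.
Variables (l : seq (int * V)) (t : int).
Let c x : int := \sum_(p <- l) p.1 * delta p.2 x.
Let R x : int := rowsum l x - 2%:R * t.

Let sum_c (f : V -> int) : \sum_x c x * f x = \sum_(p <- l) p.1 * f p.2.
Proof.
under eq_bigr => x _ do rewrite mulr_suml.
rewrite exchange_big; apply: eq_bigr => p _ /=.
by under eq_bigr => x _ do rewrite -mulrA; rewrite -mulr_sumr sum_delta.
Qed.

Let nbsum_c x : nbsum c x = \sum_(p <- l) p.1 * adj p.2 x.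
Proof.
rewrite /nbsum; under eq_bigr => y _ do rewrite mulrC.
by rewrite sum_c; apply: eq_bigr => p _; rewrite adj_sym.
Qed.

Let R_E x : R x = nbsum c x - 2%:R * c x - 2%:R * t.
Proof.
rewrite /R /rowsum nbsum_c /c mulr_sumr -sumrB; congr (_ - _).
by apply: eq_bigr => p _; ring.
Qed.

Let weight_c : \sum_x c x = weight l.
Proof.
under eq_bigr => x _ do rewrite -[c x]mulr1.
by rewrite sum_c; under eq_bigr => p _ do rewrite mulr1.
Qed.

Let R_eig x : nbsum R x = - 10%:R * R x + 12%:R * weight l - 84%:R * t.
Proof.
transitivity (\sum_y (adj x y * nbsum c y - 2%:R * (adj x y * c y) - 2%:R * t * (adj x y * 1))).
  by apply: eq_bigr => y _; rewrite R_E; ring.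
rewrite !sumrB -!mulr_sumr [\sum_i adj x i * nbsum c i]nbsum2 weight_c R_E.
have -> : \sum_y adj x y * 1 = 32%:R.
  have [_ [deg _]] := srg_e; rewrite -(deg x) -sum_bool.
  by apply: eq_bigr => y _; rewrite mulr1.
by rewrite -/(nbsum c x); ring.
Qed.

Let R_sq : \sum_x R x ^+ 2 = 12%:R * quad l + 12%:R * weight l ^+ 2 - 120%:R * t * weight l + 420%:R * t ^+ 2.
Proof.
have q : 2%:R * (\sum_x c x ^+ 2) - \sum_x c x * nbsum c x = quad l.
  under eq_bigr => x _ do rewrite expr2.
  rewrite !sum_c mulr_sumr -sumrB; apply: eq_bigr => p _.
  rewrite nbsum_c /c mulr_sumr mulr_sumr mulr_sumr -sumrB; apply: eq_bigr => r _.
  by rewrite (adj_sym r.2) (delta_sym r.2); ring.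
transitivity (\sum_x ((nbsum c x - 2%:R * c x) ^+ 2 - 4%:R * t * nbsum c x + 8%:R * t * c x + 4%:R * t ^+ 2)).
  by apply: eq_bigr => x _; rewrite R_E; ring.
rewrite !big_split sumrN /= -!mulr_sumr sum_sqr q sum_nbsum weight_c sum_const.
by ring.
Qed.

(** A row sums to 30 and the constant vector 2 sums to 210 = 7 * 30, so weight 7t puts
    [rowsum l - 2t] into the -10 eigenspace. The condition on [quad] says that its norm is 24. *)
Lemma no_root : weight l = 7%:R * t -> quad l = 2%:R - 14%:R * t ^+ 2 -> False.
Proof.
move=> w q; apply: (@no_small_eigenvector R) => [x|].
  by rewrite R_eig w; ring.
by rewrite R_sq w q; ring.
Qed.

(** With one more unit of weight the sum is that of a single row; the condition on [quad] says that
    the norm is 36. *)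
Lemma virtual_vertex : weight l = 7%:R * t + 1 -> quad l = 2%:R - 4%:R * t - 14%:R * t ^+ 2 ->
  exists w, forall x, rowsum l x - 2%:R * t = adj w x - 2%:R * delta w x.
Proof.
move=> w q; apply: (@vertex_row R) => [x|].
  by rewrite R_eig w; ring.
by rewrite R_sq w q; ring.
Qed.

End Combination.

Lemma quad_nil : quad [::] = 0.
Proof. by rewrite /quad big_nil. Qed.

Lemma quad_cons p l : quad (p :: l) =
  2%:R * p.1 ^+ 2 + 2%:R * p.1 * (\sum_(q <- l) q.1 * (2%:R * delta p.2 q.2 - adj p.2 q.2)) + quad l.
Proof.
rewrite /quad !big_cons /= [delta p.2 p.2]/delta [adj p.2 p.2]/adj e_irr eqxx /=.
under [X in _ + X = _]eq_bigr => q _ do rewrite big_cons.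
rewrite big_split /= mulr_sumr.
have -> : \sum_(q <- l) q.1 * p.1 * (2%:R * delta q.2 p.2 - adj q.2 p.2) =
          \sum_(q <- l) p.1 * q.1 * (2%:R * delta p.2 q.2 - adj p.2 q.2).
  by apply: eq_bigr => q _; rewrite (delta_sym q.2) (adj_sym q.2); ring.
set a := \sum_(q <- l) p.1 * _ * _.
have -> : \sum_(q <- l) 2%:R * p.1 * (q.1 * (2%:R * delta p.2 q.2 - adj p.2 q.2)) = 2%:R * a.
  by rewrite mulr_sumr; apply: eq_bigr => q _; ring.
by ring.
Qed.

Lemma row_le1 w v : adj w v - 2%:R * delta w v <= 1.
Proof. by rewrite /adj /delta; case: (e w v); case: (w == v). Qed.

Lemma e_neq x y : e x y -> (x == y) = false.
Proof. by apply: contraTF => /eqP ->; rewrite e_irr. Qed.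

Lemma card_common x y : e x y -> #|[set z | e x z & e y z]| = 4%N.
Proof. by have [_ [_ [lam _]]] := srg_e; exact: lam. Qed.

Lemma card_nb x : #|[set y | e x y]| = 32%N.
Proof. by have [_ [deg _]] := srg_e; exact: deg. Qed.

Lemma card_common_far x y : x != y -> ~~ e x y -> #|[set z | e x z & e y z]| = 12%N.
Proof. by have [_ [_ [_ mu]]] := srg_e; exact: mu. Qed.

(** Weight 2 on each vertex of a K4 gives total weight 8 and [quad] = 32 - 48 = -16, hence a row (t
    = 1). Of the four common neighbours of [a] and [b], some [v] differs from [x] and [c]; the
    combination is at least 2 + 2 - 2 = 2 there, but a row has no entry above 1. *)
Lemma noK4 x a b c : e x a -> e x b -> e x c -> e a b -> e b c -> e a c -> False.
Proof.
move=> xa xb xc ab bc ac.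
pose l := [:: (2%:R : int, x); (2%:R, a); (2%:R, b); (2%:R, c)].
have [||w row] := @virtual_vertex l 1.
- by rewrite /weight !big_cons big_nil.
- rewrite !quad_cons quad_nil !big_cons !big_nil /= /adj /delta.
  by rewrite xa xb xc ab bc ac !e_neq.
have [v vab vxc] : exists2 v, v \in [set z | e a z & e b z] & v \notin [set x; c].
  apply/subsetPn; apply: contraL isT => /subset_leq_card.
  by rewrite card_common // cards2; case: (_ != _).
move: vab vxc; rewrite !inE negb_or => /andP[av bv] /andP[vx vc].
have := row_le1 w v; rewrite -row /rowsum !big_cons big_nil /= /adj /delta av bv.
rewrite (e_neq av) (e_neq bv) !(eq_sym _ v) (negbTE vx) (negbTE vc).
by case: (e x v); case: (e c v).
Qed.

(** With weight 2 on the hub and 1 on the rim, the wheel has weight 7 and [quad] = 8 + 10 - 20 - 10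
    = -12, the values excluded by [no_root] for t = 1. Chords of the rim are excluded by [noK4]. *)
Lemma noC5 x a b c d f : e x a -> e x b -> e x c -> e x d -> e x f ->
  e a b -> e b c -> e c d -> e d f -> e f a ->
  a != c -> a != d -> b != d -> b != f -> c != f -> False.
Proof.
move=> xa xb xc xd xf ab bc cd df fa ac ad bd bf cf.
have tri u v w : e x u -> e x v -> e x w -> e u v -> e v w -> e u w = false.
  by move=> xu xv xw uv vw; apply/negP => uw; exact: (noK4 xu xv xw).
pose l := [:: (2%:R : int, x); (1, a); (1, b); (1, c); (1, d); (1, f)].
apply: (@no_root l 1).
- by rewrite /weight !big_cons big_nil.
- rewrite !quad_cons quad_nil !big_cons !big_nil /= /adj /delta.
  rewrite xa xb xc xd xf ab bc cd df (e_sym a f) fa.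
  rewrite (tri a b c) // (tri b c d) // (tri c d f) // (e_sym a d) (tri d f a) // (e_sym b f) (tri f a b) //.
  by rewrite !(e_neq xa, e_neq xb, e_neq xc, e_neq xd, e_neq xf) (e_neq ab) (e_neq bc) (e_neq cd) (e_neq df)
    (eq_sym a f) (e_neq fa) (negbTE ac) (negbTE ad) (negbTE bd) (negbTE bf) (negbTE cf).
Qed.

End Eigenvectors.

(** * The graph induced on a neighbourhood without 4-cycles *)

Section LocalGraph.
Set Implicit Arguments. Unset Strict Implicit. Unset Printing Implicit Defensive.
Variables (V : finType) (e : rel V).
Hypotheses (simple_e : simple_graph e) (srg_e : srg e 105 32 4 12).
Variable x : V.
Hypothesis wheel : forall a b c d, e x a -> e x b -> e x c -> e x d ->
  e a b -> e b c -> e c d -> e d a -> a != c -> b = d.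

Let esym := e_sym simple_e.
Let eirr := e_irr simple_e.

Definition common (y : V) := [set n | e x n & e y n].

Lemma in_common y n : (n \in common y) = e x n && e y n.
Proof. by rewrite inE. Qed.

Lemma common_sym y n : e x y -> e x n -> (n \in common y) = (y \in common n).
Proof. by move=> xy xn; rewrite !in_common xy xn esym. Qed.

Lemma card_common4 z : e x z -> #|common z| = 4.
Proof. exact: card_common. Qed.

Lemma no_triangle a b c : e x a -> e x b -> e x c -> e a b -> e b c -> e a c = false.
Proof.
by move=> xa xb xc ab bc; apply/negP => ac; exact: (noK4 simple_e srg_e xa xb xc ab bc ac).
Qed.

Lemma uniq_common a b u v : e x a -> e x b -> a != b -> e x u -> e x v ->
  e a u -> e b u -> e a v -> e b v -> u = v.
Proof.
by move=> xa xb ab xu xv au bu av bv; apply: (@wheel a u b v); rewrite // esym.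
Qed.

(** If two nonconsecutive vertices of the closed walk coincide, it contains a triangle; otherwise
    [noC5] applies. *)
Lemma no_pentagon a b c d f : e x a -> e x b -> e x c -> e x d -> e x f ->
  e a b -> e b c -> e c d -> e d f -> e f a = false.
Proof.
move=> xa xb xc xd xf ab bc cd df; apply/negP => fa.
have neq u v w : e x u -> e x v -> e x w -> e u v -> e v w -> e u w = false := no_triangle (a := u) (b := v) (c := w).
have [ac|ac] := eqVneq a c; first by have := neq f a d xf xa xd fa; rewrite ac cd (esym f) df => /(_ isT).
have [ad|ad] := eqVneq a d; first by have := neq a b c xa xb xc ab bc; rewrite ad esym cd.
have [bd|bd] := eqVneq b d; first by have := neq f a b xf xa xb fa ab; rewrite bd (esym f) df.
have [bf|bf] := eqVneq b f; first by have := neq b c d xb xc xd bc cd; rewrite bf (esym f) df.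
have [cf|cf] := eqVneq c f; first by have := neq f a b xf xa xb fa ab; rewrite -cf (esym c) bc.
exact: (noC5 simple_e srg_e xa xb xc xd xf ab bc cd df fa ac ad bd bf cf).
Qed.

Local Open Scope ring_scope.

(** The four common neighbours are pairwise nonadjacent by [no_triangle], so the combination has
    weight 8 and [quad] = 24 - 40 = -16: again the case t = 1. *)
Lemma mid_exists z : e x z -> exists y, forall w,
  adj e y w - 2%:R * delta y w = 2%:R * (adj e x w - 2%:R * delta x w) + 2%:R * (adj e z w - 2%:R * delta z w)
    + \sum_(n in common z) (adj e n w - 2%:R * delta n w) - 2%:R.
Proof.
move=> xz; have := card_common4 xz; rewrite cardE.
have mem n : n \in enum (common z) -> e x n && e z n by rewrite mem_enum in_common.
have nn u v : u \in enum (common z) -> v \in enum (common z) -> e u v = false.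
  move=> /mem /andP[xu zu] /mem /andP[xv zv]; rewrite esym in zu.
  by apply: (no_triangle xu xz xv zu zv).
have E f : \sum_(n in common z) f n = \sum_(n <- enum (common z)) f n :> int.
  by rewrite big_enum.
have := enum_uniq (common z).
case: (enum _) E mem nn => [|n1 [|n2 [|n3 [|n4 []]]]] // E mem nn + _.
rewrite /= !inE !negb_or !andbT -!andbA => /and5P[d12 d13 d14 d23 /andP[d24 d34]].
have [] : [/\ e x n1 && e z n1, e x n2 && e z n2, e x n3 && e z n3 & e x n4 && e z n4].
  by split; apply: mem; rewrite !inE eqxx ?orbT.
move=> /andP[x1 z1] /andP[x2 z2] /andP[x3 z3] /andP[x4 z4].
pose l := [:: (2%:R : int, x); (2%:R, z); (1, n1); (1, n2); (1, n3); (1, n4)].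
have [||y row] := @virtual_vertex _ _ simple_e srg_e l 1.
- by rewrite /weight !big_cons big_nil.
- rewrite !(quad_cons simple_e) quad_nil !big_cons !big_nil /= /adj /delta xz x1 x2 x3 x4 z1 z2 z3 z4.
  rewrite (nn n1 n2) ?(nn n1 n3) ?(nn n1 n4) ?(nn n2 n3) ?(nn n2 n4) ?(nn n3 n4) ?inE ?eqxx ?orbT //.
  by rewrite !(e_neq simple_e xz, e_neq simple_e x1, e_neq simple_e x2, e_neq simple_e x3,
    e_neq simple_e x4, e_neq simple_e z1, e_neq simple_e z2, e_neq simple_e z3, e_neq simple_e z4)
    (negbTE d12) (negbTE d13) (negbTE d14) (negbTE d23) (negbTE d24) (negbTE d34).
by exists y => w; rewrite -row /rowsum E !big_cons !big_nil /=; ring.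
Qed.

(* The vertex with row 2x + 2z + (sum over the common neighbours of x and z) - 2. *)
Definition mid z : V := odflt x [pick y | [forall w,
  adj e y w - 2%:R * delta y w == 2%:R * (adj e x w - 2%:R * delta x w) + 2%:R * (adj e z w - 2%:R * delta z w)
    + \sum_(n in common z) (adj e n w - 2%:R * delta n w) - 2%:R]].

Lemma mid_row z w : e x z ->
  adj e (mid z) w - 2%:R * delta (mid z) w = 2%:R * (adj e x w - 2%:R * delta x w)
    + 2%:R * (adj e z w - 2%:R * delta z w)
    + (#|common z :&: [set n | e n w]|%:R - 2%:R * (w \in common z)%:R) - 2%:R.
Proof.
move=> xz; rewrite /mid; case: pickP => [y /forallP/(_ w)/eqP -> |none]; last first.
  have [y row] := mid_exists xz; have := none y.
  by rewrite (introT forallP) // => v; apply/eqP.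
congr (_ + _ - _); rewrite sumrB; congr (_ - _).
  rewrite -sum1_card natr_sum [RHS]big_mkcond [LHS]big_mkcond /=; apply: eq_bigr => n _.
  by rewrite !inE /adj; case: (e x n); case: (e z n); case: (e n w).
rewrite -mulr_sumr; congr (_ * _); rewrite big_mkcond /=.
rewrite -(sum_delta (fun n => (n \in common z)%:R) w); apply: eq_bigr => n _.
by rewrite /delta eq_sym; case: (n \in common z); rewrite /= ?mulr1 ?mulr0.
Qed.

Lemma rowE y w : adj e y w - 2%:R * delta y w = if y == w then - 2%:R else (e y w)%:R.
Proof. by rewrite /adj /delta; case: eqVneq => [->|_]; rewrite ?eirr //=; case: (e y w). Qed.

(** Entries of a row are -2, 0 or 1, so a nonnegative value of the combination rules out equality
    and decides adjacency. *)
Lemma row_ge0 y w (k : nat) : adj e y w - 2%:R * delta y w = k%:R -> y != w /\ e y w = (k != 0%N).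
Proof.
rewrite rowE; case: eqVneq => [_|_]; first by lia.
by case: (e y w) => /=; case: k => [|k]; lia.
Qed.

Lemma mid_center z : e x z -> mid z != x /\ e x (mid z) = false.
Proof.
move=> xz; suff [-> ] : mid z != x /\ e (mid z) x = (0 != 0)%N by rewrite esym.
apply: row_ge0; rewrite mid_row // /adj /delta eirr eqxx esym xz eq_sym (e_neq simple_e xz).
rewrite in_common eirr; have -> : common z :&: [set n | e n x] = common z.
  by apply/setP => n; rewrite !inE (esym n) ; case: (e x n); rewrite // andbT.
by rewrite card_common4.
Qed.

Lemma mid_end z : e x z -> mid z != z /\ e (mid z) z = false.
Proof.
move=> xz; apply: (@row_ge0 _ _ 0); rewrite mid_row // /adj /delta eirr eqxx xz (e_neq simple_e xz).
rewrite in_common eirr andbF; have -> : common z :&: [set n | e n z] = common z.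
  by apply/setP => n; rewrite !inE (esym n) ; case: (e z n); rewrite ?andbT ?andbF.
by rewrite card_common4.
Qed.

Lemma mid_common z n : e x z -> n \in common z -> e (mid z) n = false.
Proof.
move=> xz nz; have := nz; rewrite in_common => /andP[xn zn].
suff [] : mid z != n /\ e (mid z) n = (0 != 0)%N by [].
apply: row_ge0; rewrite mid_row // /adj /delta xn zn nz (e_neq simple_e xn) (e_neq simple_e zn).
have -> : common z :&: [set n0 | e n0 n] = set0.
  apply/setP => u; rewrite !inE; apply/negbTE/negP => /andP[/andP[xu zu] un].
  by have := no_triangle xz xu xn zu un; rewrite zn.
by rewrite cards0.
Qed.

(** By [card_common2] these are the vertices at distance 2 from [z] in the graph induced on the
    neighbourhood of [x]. In this form the set visibly depends on [mid z] only, and its size is the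
    parameter 12. *)
Definition sphere2 z := [set w | e x w & e (mid z) w].

Lemma card_sphere2 z : e x z -> #|sphere2 z| = 12%N.
Proof.
move=> xz; have [mx xm] := mid_center xz.
by apply: (card_common_far srg_e); rewrite ?xm // eq_sym.
Qed.

(** At such a [w] the row of [mid z] has the entry 2 + 0 + |common z & common w| - 2, so the size of
    the intersection is itself the entry. *)
Lemma card_common2 z w : e x z -> e x w -> w != z -> w \notin common z ->
  #|common z :&: common w| = (w \in sphere2 z).
Proof.
move=> xz xw wz wn.
have := mid_row w xz; rewrite /adj /delta xw (e_neq simple_e xw) (eq_sym z) (negbTE wz) (negbTE wn).
have -> : e z w = false by move: wn; rewrite in_common xw => /negbTE.
have -> : common z :&: [set n | e n w] = common z :&: common w.
  by apply/setP => u; rewrite !inE (esym u); case: (e x u).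
rewrite inE xw /= => row.
have : adj e (mid z) w - 2%:R * delta (mid z) w = #|common z :&: common w|%:R by rewrite /adj /delta row; lia.
rewrite rowE; case: eqVneq => _; first by lia.
by case: (e (mid z) w); lia.
Qed.

Lemma sphere2_proper z w : w \in sphere2 z -> e x z -> [/\ e x w, w != z, w \notin common z & e z w = false].
Proof.
rewrite inE => /andP[xw mw] xz.
have wn : w \notin common z by apply: contraTN mw => /(mid_common xz) ->.
split=> //; last by apply: contraNF wn; rewrite in_common xw.
by apply: contraTneq mw => ->; have [_ ->] := mid_end xz.
Qed.

(** The row of [mid r] is evaluated at [mid z]: [x] and [r] contribute 0, which leaves the size of
    the intersection minus 2. The entry is -2, 1 or 0 as the two middle vertices are equal, adjacent
    or neither. *)
Lemma card_common_sphere2 z r : e x z -> e x r -> r \notin sphere2 z ->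
  #|common r :&: sphere2 z| = if mid r == mid z then 0%N else (2 + e (mid r) (mid z))%N.
Proof.
move=> xz xr rS; have [mx xm] := mid_center xz.
have rm : e r (mid z) = false by move: rS; rewrite inE xr esym => /negbTE.
have rmz : r != mid z by apply: contraTneq xr => ->; rewrite xm.
have := mid_row (mid z) xr; rewrite rowE /adj /delta xm rm (eq_sym x) (negbTE mx) (negbTE rmz).
have -> : (mid z \in common r) = false by rewrite in_common xm.
have -> : common r :&: [set n | e n (mid z)] = common r :&: sphere2 z.
  by apply/setP => u; rewrite !inE (esym u); case: (e x u).
by case: eqP => _; [|case: (e _ _)]; lia.
Qed.

Lemma edge_count (A B : {set V}) : (forall a, a \in A -> e x a) -> (forall b, b \in B -> e x b) ->
  (\sum_(a in A) #|common a :&: B| = \sum_(b in B) #|common b :&: A|)%N.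
Proof.
have cnt (a : V) (D : {set V}) : e x a -> (forall b, b \in D -> e x b) ->
    (#|common a :&: D| = \sum_(b in D) e a b)%N.
  move=> xa xD; rewrite -sum1_card big_mkcond [RHS]big_mkcond /=.
  apply: eq_bigr => b _; rewrite !inE; case bD: (b \in D); rewrite ?andbF // andbT xD //.
move=> xA xB; under eq_bigr => a aA do rewrite (cnt _ _ (xA a aA) xB).
rewrite exchange_big /=; apply: eq_bigr => b bB.
by rewrite (cnt _ _ (xB b bB) xA); apply: eq_bigr => a _; rewrite esym.
Qed.

Local Close Scope ring_scope.

(** The remaining 32 - 1 - 4 - 12 = 15 neighbours of [x]. Seen from a point of the affine plane, the
    twins will be the other 3 points on its vertical line and the opposites the 12 nonvertical lines
    that miss it. *)
Definition far z := [set r | [&& e x r, r != z, r \notin common z & r \notin sphere2 z]].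
Definition twins z := [set r in far z | mid r == mid z].
Definition opposites z := [set r in far z | e (mid r) (mid z)].

Lemma farP z r : r \in far z -> [/\ e x r, r != z, r \notin common z & r \notin sphere2 z].
Proof. by rewrite inE => /and4P. Qed.

Lemma far_common z r n : e x z -> r \in far z -> n \in common r -> n \notin common z.
Proof.
move=> xz /farP[xr rz rC rS] nr; apply/negP => nz.
have := card_common2 xz xr rz rC; rewrite (negbTE rS) => /eqP; rewrite cards_eq0 => /eqP/setP/(_ n).
by rewrite in_setI nz nr inE.
Qed.

Lemma sphere2_branch z d : e x z -> d \in sphere2 z -> exists n, n \in common z :&: common d.
Proof.
move=> xz dS; have [xd dz dC _] := sphere2_proper dS xz.
by apply/set0Pn; rewrite -card_gt0 card_common2 // dS.
Qed.

Lemma sphere2_indep z d d' : e x z -> d \in sphere2 z -> d' \in sphere2 z -> e d d' = false.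
Proof.
move=> xz dS d'S; apply/negP => dd'.
have [n] := sphere2_branch xz dS; have [n'] := sphere2_branch xz d'S.
rewrite !inE => /andP[/andP[xn' zn'] /andP[_ d'n']] /andP[/andP[xn zn] /andP[_ dn]].
have [xd _ _ _] := sphere2_proper dS xz; have [xd' _ _ _] := sphere2_proper d'S xz.
have := @no_pentagon z n d d' n' xz xn xd xd' xn' zn _ dd' d'n'.
by rewrite (esym n d) dn (esym n' z) zn' => /(_ isT).
Qed.

Lemma card_sphere2_far z d : e x z -> d \in sphere2 z -> #|common d :&: far z| = 3.
Proof.
move=> xz dS; have [xd dz dC zd] := sphere2_proper dS xz.
have := card_common2 xz xd dz dC; rewrite dS setIC => one.
have -> : common d :&: far z = common d :\: common z.
  apply/setP => u; rewrite in_setI in_setD; case ud: (u \in common d); rewrite ?andbF //= andbT.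
  have := ud; rewrite in_common => /andP[xu du]; rewrite inE xu /=.
  have -> : u != z by apply: contraTneq du => ->; rewrite esym zd.
  have -> : u \notin sphere2 z by apply: contraTN du => uS; rewrite (sphere2_indep xz dS uS).
  by rewrite andbT.
by rewrite cardsD one card_common4.
Qed.

(** If [u] were no twin, it would have at least two neighbours in [sphere2 z]; with the three of [r]
    this makes five vertices. Each hangs on one of the four vertices of [common z], and sharing a
    branch would close a 4-cycle through [r] or through [u], or a 5-cycle through the edge between
    them. *)
Lemma opposite_twin z r u : e x z -> r \in opposites z -> u \in common r -> u \notin sphere2 z ->
  u \in twins z.
Proof.
move=> xz; rewrite inE => /andP[rF rz] ur uS.
have [xr rnz rC rS] := farP rF; have := ur; rewrite in_common => /andP[xu ru].
have uF : u \in far z.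
  rewrite inE xu uS (far_common xz rF ur) /= andbT.
  by apply: contraNneq rC => <-; rewrite (common_sym xu xr).
rewrite inE uF /=; apply: contraT => muz.
have two : 1 < #|common u :&: sphere2 z| by rewrite card_common_sphere2 // (negbTE muz).
have three : #|common r :&: sphere2 z| = 3.
  rewrite card_common_sphere2 // rz; case: eqVneq => // eq_m.
  by move: rz; rewrite eq_m eirr.
pose D := (common r :&: sphere2 z) :|: (common u :&: sphere2 z).
pose branch d := odflt z [pick n in common z :&: common d].
have branchP d : d \in D -> [/\ e x d, e x (branch d), e z (branch d) & e d (branch d)].
  move=> dD; have dS : d \in sphere2 z by move: dD; rewrite !in_setU !in_setI => /orP[]/andP[].
  have [xd _ _ _] := sphere2_proper dS xz.
  rewrite /branch; case: pickP => [n|none] /=; first by rewrite !inE => /andP[/andP[-> ->] /andP[_ ->]].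
  by have [n nI] := sphere2_branch xz dS; rewrite none in nI.
have disj : #|D| = #|common r :&: sphere2 z| + #|common u :&: sphere2 z|.
  rewrite cardsU; have -> : (common r :&: sphere2 z) :&: (common u :&: sphere2 z) = set0.
    apply/setP => d; rewrite !in_setI !in_common inE; apply/negP => /andP[/andP[/andP[xd rd] _] /andP[/andP[_ ud] _]].
    by have := no_triangle xr xu xd ru ud; rewrite rd.
  by rewrite cards0 subn0.
have nb v n d : n \in far z -> n = v -> d \in common n -> e v d by move=> _ <-; rewrite in_common => /andP[].
have mixed d d' : d \in common r :&: sphere2 z -> d' \in common u :&: sphere2 z -> branch d = branch d' -> False.
  move=> dr d'u bb'; have dD : d \in D by rewrite in_setU dr.
  have d'D : d' \in D by rewrite in_setU d'u orbT.
  have [xd xb zb db] := branchP _ dD; have [xd' _ _ d'b] := branchP _ d'D.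
  move: dr d'u; rewrite !in_setI !in_common => /andP[/andP[_ rd] _] /andP[/andP[_ ud'] _].
  have bd : e (branch d) d by rewrite esym.
  have dr : e d r by rewrite esym.
  by have := no_pentagon xb xd xr xu xd' bd dr ru ud'; rewrite bb' d'b.
have inj : {in D &, injective branch}.
  move=> d d' dD d'D bb'.
  have [xd xb zb db] := branchP _ dD; have [xd' _ _ d'b] := branchP _ d'D.
  have same v : v \in far z -> d \in common v -> d' \in common v -> d = d'.
    move=> vF; have [xv _ vC _] := farP vF; rewrite !in_common => /andP[_ vd] /andP[_ vd'].
    have bd : e (branch d) d by rewrite esym.
    have bd' : e (branch d) d' by rewrite bb' esym.
    apply: (@uniq_common v (branch d)) => //.
    by apply: contraNneq vC => ->; rewrite in_common xb.
  move: dD d'D; rewrite !in_setU => /orP[dr|du] /orP[d'r|d'u].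
  - by apply: (same r) => //; [move: dr|move: d'r]; rewrite in_setI => /andP[].
  - by case: (mixed _ _ dr d'u).
  - by case: (mixed _ _ d'r du).
  - by apply: (same u) => //; [move: du|move: d'u]; rewrite in_setI => /andP[].
have : #|branch @: D| <= #|common z|.
  apply: subset_leq_card; apply/subsetP => _ /imsetP[d dD ->].
  by have [_ xb zb _] := branchP _ dD; rewrite in_common xb.
by rewrite (card_in_imset inj) disj three card_common4 //; move: two; clear; lia.
Qed.

(** The other three neighbours of [v] are at distance 2 from [u], hence in [sphere2 u = sphere2 z];
    by [card_common_sphere2] the number three means that the middle vertices are adjacent. *)
Lemma twin_opposite z u v : e x z -> u \in twins z -> v \in common u -> v \in opposites z.
Proof.
move=> xz; rewrite inE => /andP[uF /eqP muz] vu.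
have [xu unz uC uS] := farP uF; have := vu; rewrite in_common => /andP[xv uv].
have S_eq : sphere2 u = sphere2 z by rewrite /sphere2 muz.
have vS : v \notin sphere2 z by rewrite -S_eq inE xv mid_common.
rewrite inE; apply/andP; split.
  rewrite inE xv vS (far_common xz uF vu) /= andbT.
  by apply: contraNneq uC => <-; rewrite common_sym.
have : #|common v :&: sphere2 u| = 3.
  have -> : common v :&: sphere2 u = common v :\ u.
    apply/setP => w; rewrite in_setI in_setD1; case wu: (w == u) => /=.
      by rewrite (eqP wu) [u \in sphere2 u]inE; have [_ ->] := mid_end xu; rewrite !andbF.
    apply: andb_idr => wv; have := wv; rewrite in_common => /andP[xw vw].
    have wC : w \notin common u by rewrite in_common xw (no_triangle xu xv xw uv vw).
    have := card_common2 xu xw (negbT wu) wC.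
    case: (w \in sphere2 u) => // /eqP; rewrite cards_eq0 => /eqP/setP/(_ v).
    by rewrite in_setI vu -common_sym // wv inE.
  by have := cardsD1 u (common v); rewrite card_common4 // -common_sym // vu => -[].
have vSu : v \notin sphere2 u by rewrite S_eq.
rewrite card_common_sphere2 // muz; case: eqP => // _; by case: (e _ _).
Qed.

(** Let there be t twins and o opposites. Counting the edges between [far z] and [sphere2 z] gives
    12 * 3 = 2 * 15 + o - 2t, and counting those between twins and opposites gives o = 4t. *)
Lemma card_far z : e x z -> [/\ #|twins z| = 3, #|opposites z| = 12 & #|far z| = 15].
Proof.
move=> xz.
have far_nb r : r \in far z -> e x r by case/farP.
have S_nb d : d \in sphere2 z -> e x d by move/sphere2_proper/(_ xz); case.
have twF : twins z \subset far z by apply/subsetP => r; rewrite inE => /andP[].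
have opF : opposites z \subset far z by apply/subsetP => r; rewrite inE => /andP[].
have cfar : #|far z| = 15.
  have D : [set r | e x r] = z |: (common z :|: (sphere2 z :|: far z)).
    apply/setP => r; rewrite !inE; case xr: (e x r) => //=; last first.
      by case: eqP xr => [->|//]; rewrite xz.
    by case: (r == z); case: (e z r); case: (e (mid z) r).
  have := card_nb srg_e x; rewrite D cardsU1 cardsU card_common4 // cardsU card_sphere2 //.
  have -> : sphere2 z :&: far z = set0.
    by apply/setP => r; rewrite in_setI !inE; case: (e x r); case: (e (mid z) r); rewrite ?andbF.
  have -> : common z :&: (sphere2 z :|: far z) = set0.
    apply/setP => r; rewrite in_setI in_setU [RHS]inE; apply/negP => /andP[rC /orP[rS|rF]].
      by have [_ _ + _] := sphere2_proper rS xz; rewrite rC.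
    by have [_ _ + _] := farP rF; rewrite rC.
  rewrite !inE xz eirr eqxx cards0 /=; have [_ ->] := mid_end xz; lia.
have e1 : \sum_(r in far z) #|common r :&: sphere2 z| = 36.
  rewrite edge_count //; under eq_bigr => d dS do rewrite card_sphere2_far //.
  by rewrite sum_nat_const card_sphere2.
have e2 : #|opposites z| = 4 * #|twins z|.
  have := edge_count (fun r rO => far_nb r (subsetP opF r rO)) (fun r rT => far_nb r (subsetP twF r rT)).
  have -> : \sum_(b in twins z) #|common b :&: opposites z| = 4 * #|twins z|.
    rewrite mulnC -sum_nat_const; apply: eq_bigr => u uT.
    have -> : common u :&: opposites z = common u.
      by apply/setIidPl/subsetP => v; exact: twin_opposite.
    by rewrite card_common4 // far_nb // (subsetP twF).
  move=> <-; rewrite -sum1_card; apply: eq_bigr => r rO.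
  have rF := subsetP opF _ rO; have xr := far_nb _ rF.
  have -> : common r :&: twins z = common r :\: sphere2 z.
    apply/setP => u; rewrite in_setI in_setD andbC; apply: andb_id2r => ur.
    apply/idP/idP => [uT|uS]; last exact: (opposite_twin xz rO ur).
    by have [_ _ _ ->] := farP (subsetP twF _ uT).
  rewrite cardsD card_common4 // card_common_sphere2 //; last by have [_ _ _ ->] := farP rF.
  move: rO; rewrite inE => /andP[_ rz]; rewrite rz.
  by case: eqP rz => // ->; rewrite eirr.
have e3 : \sum_(r in far z) #|common r :&: sphere2 z| + 2 * #|twins z| = 2 * #|far z| + #|opposites z|.
  have cnt (P : pred V) : #|[set r in far z | P r]| = \sum_(r in far z) P r.
    rewrite -sum1_card big_mkcond [RHS]big_mkcond /=; apply: eq_bigr => r _.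
    by rewrite inE; case: (r \in far z) => //=; case: (P r).
  rewrite /twins /opposites !cnt mulnC -[_ * #|_|]mulnC -sum_nat_const big_distrl -!big_split /=.
  apply: eq_bigr => r rF; have [xr _ _ rS] := farP rF.
  rewrite card_common_sphere2 //; case: eqP => [->|_]; first by rewrite eirr.
  by case: (e _ _).
by move: e3; rewrite cfar e1 e2 => e3; split; lia.
Qed.

Lemma mid_neq_common z w : e x z -> w \in common z -> mid w != mid z.
Proof.
move=> xz wz; have := wz; rewrite in_common => /andP[xw zw].
have [u uw] : exists u, u \in common w :\ z.
  apply/set0Pn; rewrite -card_gt0.
  by have := cardsD1 z (common w); rewrite card_common4 //; lia.
move: uw; rewrite in_setD1 => /andP[uz uw]; have := uw; rewrite in_common => /andP[xu wu].
have uC : u \notin common z by rewrite in_common xu (no_triangle xz xw xu zw wu).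
have uS : u \in sphere2 z.
  have := card_common2 xz xu uz uC; case: (u \in sphere2 z) => // /eqP.
  by rewrite cards_eq0 => /eqP/setP/(_ w); rewrite in_setI wz -common_sym // uw inE.
apply: contraTneq uS => mwz; rewrite inE -mwz.
by rewrite mid_common // andbF.
Qed.

Lemma mem_twins z w : e x z -> (w \in twins z) = [&& e x w, mid w == mid z & w != z].
Proof.
move=> xz; rewrite !inE; case xw: (e x w) => //=; case: eqVneq => [->|wz] /=; first by rewrite andbF.
rewrite andbT andbC; case: eqVneq => //= mwz; apply/andP; split.
  by apply/negP => zw; have := @mid_neq_common z w xz; rewrite mwz eqxx in_common xw zw => /(_ isT).
by rewrite -mwz; have [_ ->] := mid_end xw.
Qed.

(** * Parallel classes and the bipartition into points and lines *)

Definition cls z := [set w | e x w & mid w == mid z].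

Lemma cls_refl z : e x z -> z \in cls z.
Proof. by rewrite inE eqxx => ->. Qed.

Lemma card_cls z : e x z -> #|cls z| = 4.
Proof.
move=> xz; rewrite (cardsD1 z) cls_refl //; have [<- _ _] := card_far xz; congr (_ + #|pred_of_set _|).
by apply/setP => w; rewrite mem_twins // !inE; case: (e x w); case: (mid w == _); case: (w == z).
Qed.

(** Odd distance, 1 or 3, in the neighbourhood graph: one vertex is a point and the other a line. *)
Definition opposed z w := (w \in common z) || (w \in opposites z).

(** The 3 twins and 12 opposites exhaust the 15 far vertices, so distinct middle vertices of [z] and
    a far vertex are always adjacent. *)
Lemma opp_cases z w : e x z -> e x w -> ~~ opposed z w -> (w \in cls z) || (w \in sphere2 z).
Proof.
move=> xz xw; rewrite /opposed negb_or => /andP[wC wO]; case wS: (w \in sphere2 z); rewrite ?orbT // orbF.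
have [->|wz] := eqVneq w z; first exact: cls_refl.
have wF : w \in far z by rewrite inE xw wz wC wS.
have [t3 o12 f15] := card_far xz.
have subs : twins z :|: opposites z \subset far z.
  by apply/subsetP => r; rewrite in_setU => /orP[]; rewrite inE => /andP[].
have disj : twins z :&: opposites z = set0.
  apply/setP => r; rewrite in_setI [RHS]inE; apply/negP => /andP[]; rewrite !inE => /andP[_ /eqP ->].
  by rewrite eirr andbF.
have : twins z :|: opposites z == far z by rewrite eqEcard subs cardsU disj cards0 t3 o12 f15.
move/eqP/setP/(_ w); rewrite wF in_setU (negbTE wO) orbF mem_twins // => /and3P[_ mw _].
by rewrite inE xw.
Qed.

Lemma opp_cls z w : e x z -> w \in cls z -> opposed z w = false.
Proof.
move=> xz; rewrite inE => /andP[xw mw]; apply/negP => /orP[wC|wO].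
  by have := mid_neq_common xz wC; rewrite mw.
by move: wO; rewrite inE (eqP mw) eirr andbF.
Qed.

Lemma opp_sphere2 z w : e x z -> w \in sphere2 z -> opposed z w = false.
Proof.
move=> xz wS; have [_ _ /negbTE wC _] := sphere2_proper wS xz; rewrite /opposed wC /=.
by apply/negP; rewrite inE => /andP[/farP[_ _ _]]; rewrite wS.
Qed.

Lemma cls_sphere2 z u : u \in cls z -> sphere2 u = sphere2 z.
Proof. by rewrite inE /sphere2 => /andP[_ /eqP ->]. Qed.

Lemma opp_edge z u v : e x z -> e x u -> e x v -> e u v -> opposed z v = ~~ opposed z u.
Proof.
move=> xz xu xv uv.
have vu : v \in common u by rewrite in_common xv.
case uo: (opposed z u) => /=; last first.
  case/orP: (opp_cases xz xu (negbT uo)) => [uc|uS]; rewrite /opposed.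
    have [uz|uz] := eqVneq u z; first by rewrite -uz vu.
    rewrite (@twin_opposite z u) ?orbT // mem_twins // uz andbT.
    by move: uc; rewrite inE.
  apply: contraT => vo; case/orP: (opp_cases xz xv vo) => [vc|vS].
    by move: uS; rewrite -(cls_sphere2 vc) => /sphere2_proper/(_ xv)[_ _ _]; rewrite esym uv.
  by rewrite (sphere2_indep xz uS vS) in uv.
case/orP: uo => [uC|uO].
  have := uC; rewrite in_common => /andP[_ zu].
  rewrite /opposed in_common xv (no_triangle xz xu xv zu uv) /=; apply/negP; rewrite inE => /andP[vF _].
  by have := @far_common z v u xz vF; rewrite -common_sym // vu uC => /(_ isT).
case vS: (v \in sphere2 z); first exact: opp_sphere2.
have vT := opposite_twin xz uO vu (negbT vS).
by apply: opp_cls => //; move: vT; rewrite mem_twins // inE => /and3P[-> ->].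
Qed.

Lemma opp_join z w : e x z -> e x w -> opposed z w -> exists2 u, u \in cls z & e u w.
Proof.
move=> xz xw /orP[|wO]; first by rewrite in_common => /andP[_ zw]; exists z; rewrite ?cls_refl.
have wF : w \in far z by move: wO; rewrite inE => /andP[].
have [_ _ _ wS] := farP wF.
have [u] : exists u, u \in common w :\: sphere2 z.
  apply/set0Pn; rewrite -card_gt0 cardsD card_common4 // card_common_sphere2 //.
  by move: wO; rewrite inE => /andP[_]; case: eqP => [->|_]; rewrite ?eirr // => ->.
rewrite in_setD => /andP[uS uw]; have := opposite_twin xz wO uw uS.
rewrite mem_twins // => /and3P[xu mu _]; exists u; first by rewrite inE xu mu.
by move: uw; rewrite in_common => /andP[_ wu]; rewrite esym.
Qed.

Lemma cls_uniq u u' w : e x u -> e x u' -> e x w -> mid u = mid u' -> e u w -> e u' w -> u = u'.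
Proof.
move=> xu xu' xw m uw u'w; apply: contraTeq isT => uu'.
have u'T : u' \in twins u by rewrite mem_twins // xu' m eqxx eq_sym.
have wu' : w \in common u' by rewrite in_common xw.
have := twin_opposite xu u'T wu'; rewrite inE => /andP[/farP[_ _ + _] _].
by rewrite in_common xw uw.
Qed.

(** Being opposed to [z] alternates along edges. It is therefore constant at distance 2, and also on
    a class, since two members of a class share their [sphere2]. *)
Lemma opp_trans z u v : e x z -> e x u -> e x v -> opposed u v = (opposed z u != opposed z v).
Proof.
move=> xz xu xv.
have step a b : e x a -> e x b -> e a b -> opposed z b = ~~ opposed z a := opp_edge xz.
have sph a b : e x a -> b \in sphere2 a -> opposed z b = opposed z a.
  move=> xa bS; have [xb _ _ _] := sphere2_proper bS xa.
  have [n] := sphere2_branch xa bS; rewrite !inE => /andP[/andP[xn an] /andP[_ bn]].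
  by rewrite -[LHS]negbK -(step b n) // (step a n) // negbK.
have same a b : e x a -> b \in cls a -> opposed z b = opposed z a.
  move=> xa bc; have xb : e x b by move: bc; rewrite inE => /andP[].
  have [d dS] : exists d, d \in sphere2 a by apply/set0Pn; rewrite -card_gt0 card_sphere2.
  by rewrite -(sph a d) // -(sph b d) // (cls_sphere2 bc).
case uv: (opposed u v).
  have [w wc wv] := opp_join xu xv uv; rewrite -(same u w) //.
  have xw : e x w by move: wc; rewrite inE => /andP[].
  by rewrite (step w v) //; case: (opposed z w).
by case/orP: (opp_cases xu xv (negbT uv)) => [/(same _ _ xu)|/(sph _ _ xu)] ->; rewrite eqxx.
Qed.

Lemma opp_meet z u v : e x z -> e x u -> e x v -> opposed z u = opposed z v -> mid u != mid v ->
  exists w, [/\ e x w, e u w & e v w].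
Proof.
move=> xz xu xv uv muv; have : ~~ opposed u v by rewrite (opp_trans xz) // uv eqxx.
move/(opp_cases xu xv); rewrite inE xv eq_sym (negbTE muv) /= => vS.
by have [w] := sphere2_branch xu vS; rewrite !inE => /andP[/andP[xw uw] /andP[_ vw]]; exists w.
Qed.

End LocalGraph.

(** * Coordinates over the field with four elements *)

Section Net.
Set Implicit Arguments. Unset Strict Implicit. Unset Printing Implicit Defensive.

(** [ok] prunes every prefix and [goal] is asked only of full assignments. With [goal] constantly
    false, success means that no assignment has all its prefixes accepted. *)
Fixpoint backtrack (A : Type) (dom : seq A) (ok goal : seq A -> bool) n t :=
  if ok t then
    if n is n'.+1 then all (fun r => backtrack dom ok goal n' (rcons t r)) dom else goal t
  else true.

Lemma backtrackP (A : eqType) (dom : seq A) (ok goal : seq A -> bool) s t :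
  backtrack dom ok goal (size s) t -> {subset s <= dom} -> (forall k, ok (t ++ take k s)) ->
  goal (t ++ s).
Proof.
elim: s t => [|r s IHs] t /= + dom_s ok_s; have := ok_s 0; rewrite ?take0 !cats0 => -> //.
move=> /allP/(_ r) bt; rewrite -cat_rcons; apply: IHs => [|u us|k].
- by apply: bt; apply: dom_s; rewrite inE eqxx.
- by apply: dom_s; rewrite inE us orbT.
- by rewrite cat_rcons; exact: (ok_s k.+1).
Qed.

Definition xor4 a b := nth 0 (nth [::] [:: [:: 0; 1; 2; 3]; [:: 1; 0; 3; 2]; [:: 2; 3; 0; 1]; [:: 3; 2; 1; 0]] a) b.
(* 2 and 3 stand for the two primitive elements of F_4. *)
Definition mul4 a b := nth 0 (nth [::] [:: [:: 0; 0; 0; 0]; [:: 0; 1; 2; 3]; [:: 0; 2; 3; 1]; [:: 0; 3; 1; 2]] a) b.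

(** [t] lists the permutations for m, a in {1, 2, 3} in lexicographic order; those with m = 0 or a =
    0 are the identity by the normalisation. *)
Definition row4 (t : seq (seq nat)) m a :=
  if (m == 0) || (a == 0) then iota 0 4 else nth [::] t (3 * m.-1 + a.-1).

Definition meets (r1 r2 s1 s2 : seq nat) c c' :=
  (nth 0 r1 c == nth 0 r2 c') && (nth 0 s1 c == nth 0 s2 c').

Definition net_ok (t : seq (seq nat)) :=
  let known (m a : nat) := (m == 0) || (a == 0) || (3 * m.-1 + a.-1 < size t) in
  all (fun a : nat => known 1 a ==> (nth 0 (row4 t 1 a) a == 0)) (iota 1 3) &&
  all (fun m : nat => known m 1 ==> (nth 0 (row4 t m 1) m == 0)) (iota 1 3) &&
  all (fun m : nat => all (fun m' : nat => all (fun a : nat => all (fun a' : nat =>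
    [&& known m a, known m a', known m' a & known m' a'] ==>
    ~~ has (fun c : nat => has (meets (row4 t m a) (row4 t m' a) (row4 t m a') (row4 t m' a') c) (iota 0 4)) (iota 0 4))
    (iota 0 a)) (iota 0 4)) (iota 0 m)) (iota 0 4).

Definition net_goal t := all (fun m : nat => all (fun a : nat => all (fun c : nat =>
  nth 0 (row4 t m a) c == xor4 c (mul4 m a)) (iota 0 4)) (iota 0 4)) (iota 0 4).

Lemma net_search : backtrack (permutations (iota 0 4)) net_ok net_goal 9 [::].
Proof. by vm_compute. Qed.

Lemma all4P (P : pred nat) : reflect (forall a, a < 4 -> P a) (all P (iota 0 4)).
Proof.
by apply: (iffP allP) => H a; [move=> a4; apply: H; rewrite mem_iota|rewrite mem_iota => a4; apply: H].
Qed.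

(** [f m a c] stands for the ordinate at which the line (m, c) meets the vertical line [a]. The four
    normalisations read ordinates off the lines of slope 0, intercepts off a = 0, abscissae off the
    lines of slope 1, and slopes off the lines through (1, 0); in characteristic 2, b = ma + c
    vanishes when c = ma. The last hypothesis says that lines of different slopes meet at most
    once. *)
Lemma net_unique (f : nat -> nat -> nat -> nat) :
  (forall m a c, m < 4 -> a < 4 -> c < 4 -> f m a c < 4) ->
  (forall a c, a < 4 -> c < 4 -> f 0 a c = c) -> (forall m c, m < 4 -> c < 4 -> f m 0 c = c) ->
  (forall a, a < 4 -> f 1 a a = 0) -> (forall m, m < 4 -> f m 1 m = 0) ->
  (forall m a c c', m < 4 -> a < 4 -> c < 4 -> c' < 4 -> f m a c = f m a c' -> c = c') ->
  (forall m m' a a' c c', m < 4 -> m' < 4 -> a < 4 -> a' < 4 -> c < 4 -> c' < 4 -> m != m' ->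
     f m a c = f m' a c' -> f m a' c = f m' a' c' -> a = a') ->
  forall m a c, m < 4 -> a < 4 -> c < 4 -> f m a c = xor4 c (mul4 m a).
Proof.
move=> f4 f0 f_0 f1 f_1 f_inj f_cross m a c m4 a4 c4.
pose row m a := mkseq (f m a) 4.
pose s := [:: row 1 1; row 1 2; row 1 3; row 2 1; row 2 2; row 2 3; row 3 1; row 3 2; row 3 3].
have nth_row k b d : d < 4 -> nth 0 (row k b) d = f k b d by move=> d4; rewrite nth_mkseq.
have row4E i k b d : k < 4 -> b < 4 -> d < 4 ->
    (k == 0) || (b == 0) || (3 * k.-1 + b.-1 < i) -> nth 0 (row4 (take i s) k b) d = f k b d.
  move=> k4 b4 d4; rewrite /row4; case: ifP => [kb0 _|kb0].
    by rewrite nth_iota //; case/orP: kb0 => /eqP ->; rewrite ?f0 ?f_0.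
  rewrite /= => ki; rewrite nth_take // -(nth_row k b d d4).
  by case: k b k4 b4 kb0 {ki} => [|[|[|[|]]]] // [|[|[|[|]]]].
have := backtrackP net_search (s := s); rewrite cat0s => goal.
have : net_goal s.
  apply: goal => [r|i].
    have rowP k b : k < 4 -> b < 4 -> row k b \in permutations (iota 0 4).
      move=> k4 b4; rewrite mem_permutations.
      have row_uniq : uniq (row k b).
        by rewrite map_inj_in_uniq ?iota_uniq // => d d'; rewrite !mem_iota /= => d4 d'4; exact: f_inj.
      have row_sub : {subset row k b <= iota 0 4}.
        by move=> _ /mapP[d + ->]; rewrite !mem_iota => d4; exact: f4.
      apply: uniq_perm => //; have [|_ //] := uniq_min_size row_uniq row_sub.
      by rewrite size_mkseq.
    have /allP sub : all [in permutations (iota 0 4)] s.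
      by rewrite /s; do 9![apply/andP; split; first exact: rowP].
    exact: sub.
  have known k b : (k == 0) || (b == 0) || (3 * k.-1 + b.-1 < size (take i s)) ->
      (k == 0) || (b == 0) || (3 * k.-1 + b.-1 < i).
    by case/orP => [->//|lt_k]; rewrite (leq_trans lt_k) ?orbT // size_take_min geq_minl.
  rewrite /net_ok cat0s; apply/andP; split; first (apply/andP; split).
  - apply/allP => b; rewrite mem_iota => /andP[b0 b4]; apply/implyP => /known kn.
    by rewrite row4E // f1.
  - apply/allP => k; rewrite mem_iota => /andP[k0 k4]; apply/implyP => /known kn.
    by rewrite row4E // f_1.
  apply/all4P => k k4; apply/allP => k'; rewrite mem_iota => /andP[_ k'k].
  apply/all4P => b b4; apply/allP => b'; rewrite mem_iota => /andP[_ b'b].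
  apply/implyP => /and4P[/known K1 /known K2 /known K3 /known K4].
  have [k'4 b'4] : k' < 4 /\ b' < 4 by lia.
  apply/hasPn => d; rewrite mem_iota => d4; apply/hasPn => d'; rewrite mem_iota => d'4.
  rewrite /meets !row4E //; apply/negP => /andP[/eqP E1 /eqP E2].
  by have := f_cross k k' b b' d d' k4 k'4 b4 b'4 d4 d'4 _ E1 E2; lia.
move=> /all4P/(_ m m4)/all4P/(_ a a4)/all4P/(_ c c4)/eqP <-.
have := row4E 9 m a c m4 a4 c4; rewrite take_oversize // => -> //; lia.
Qed.

(** * From an abstract bipartite neighbourhood graph to coordinates *)

Section Coordinates.
Variables (V : finType) (e : rel V) (N : pred V) (par : pred V) (mid : V -> V).
Hypothesis esym : symmetric e.
Hypothesis par_edge : forall u v, N u -> N v -> e u v -> par v = ~~ par u.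
Hypothesis par_mid : forall u v, N u -> N v -> mid u = mid v -> par u = par v.
Hypothesis card_mid : forall z, N z -> #|[set w | N w & mid w == mid z]| = 4.
Hypothesis mid_uniq : forall u u' w, N u -> N u' -> N w -> mid u = mid u' -> e u w -> e u' w -> u = u'.
Hypothesis join_ex : forall z w, N z -> N w -> par z != par w ->
  exists u, [/\ N u, mid u = mid z & e u w].
Hypothesis meet_ex : forall u v, N u -> N v -> par u = par v -> mid u != mid v ->
  exists w, [/\ N w, e u w & e v w].
Hypothesis meet_uniq : forall a b u v, N a -> N b -> a != b -> N u -> N v ->
  e a u -> e b u -> e a v -> e b v -> u = v.

Let join z w := odflt z [pick u | [&& N u, mid u == mid z & e u w]].
Let meet u v := odflt u [pick w | [&& N w, e u w & e v w]].

Let joinP z w : N z -> N w -> par z != par w -> [/\ N (join z w), mid (join z w) = mid z & e (join z w) w].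
Proof.
move=> Nz Nw zw; rewrite /join; case: pickP => [u /and3P[Nu /eqP -> ->] //|none].
by have [u [Nu mu uw]] := join_ex Nz Nw zw; have := none u; rewrite Nu mu uw eqxx.
Qed.

Let meetP u v : N u -> N v -> par u = par v -> mid u != mid v ->
  [/\ N (meet u v), e u (meet u v) & e v (meet u v)].
Proof.
move=> Nu Nv uv muv; rewrite /meet; case: pickP => [w /and3P[-> -> ->] //|none].
by have [w [Nw uw vw]] := meet_ex Nu Nv uv muv; have := none w; rewrite Nw uw vw.
Qed.

(* The normalisation makes (0,0) = z0, (1,0) = h1 and takes n0 as the line b = 0; the line of
   slope m through (1,0) is the common neighbour of h1 and the point (0,m). *)
Lemma net_coordinates z0 n0 h1 : N z0 -> N n0 -> N h1 -> ~~ par z0 -> e z0 n0 -> e n0 h1 -> h1 != z0 ->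
  exists P L : nat -> nat -> V,
    [/\ forall a b, a < 4 -> b < 4 -> N (P a b) && ~~ par (P a b),
        forall m c, m < 4 -> c < 4 -> N (L m c) && par (L m c) &
        forall a b m c, a < 4 -> b < 4 -> m < 4 -> c < 4 ->
          e (P a b) (L m c) = (b == xor4 c (mul4 m a))].
Proof.
move=> Nz Nn Nh /negbTE pz zn nh hz.
have pn : par n0 by rewrite (par_edge Nz Nn zn) pz.
have ph : par h1 = false by rewrite (par_edge Nn Nh nh) pn.
have mhz : mid z0 != mid h1.
  by apply: contraNneq hz => m; apply/eqP/(@mid_uniq _ _ n0) => //; rewrite esym.
(* The class of [z0] becomes the vertical line a = 0 with [z0] at the origin. Any order of its other
   three points will do, since [net_unique] yields the same formula for each. *)
pose vs := z0 :: enum ([set w | N w & mid w == mid z0] :\ z0).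
pose v c := nth z0 vs c.
have size_vs : size vs = 4.
  by rewrite -(card_mid Nz) (cardsD1 z0) inE Nz eqxx /= -cardE.
have uniq_vs : uniq vs by rewrite /= enum_uniq mem_enum !inE eqxx.
have v_inj c c' : c < 4 -> c' < 4 -> v c = v c' -> c = c'.
  by move=> c4 c'4 /eqP; rewrite nth_uniq ?size_vs // => /eqP.
have vP c : c < 4 -> N (v c) /\ mid (v c) = mid z0.
  move=> c4; have : v c \in vs by rewrite mem_nth ?size_vs.
  rewrite in_cons mem_enum !inE; case: eqP => [->|_] //= /andP[-> /eqP ->] //.
have v_par c : c < 4 -> par (v c) = false.
  by move=> c4; have [Nv mv] := vP c c4; rewrite (par_mid Nv Nz mv).
pose k c := meet (v c) h1.
have kP c : c < 4 -> [/\ N (k c), e (v c) (k c), e h1 (k c) & par (k c)].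
  move=> c4; have [Nv mv] := vP c c4.
  have [||Nk vk hk] := @meetP (v c) h1 Nv Nh; first by rewrite v_par.
    by rewrite mv.
  by split=> //; rewrite (par_edge Nv Nk vk) v_par.
have k_mid c c' : c < 4 -> c' < 4 -> mid (k c) = mid (k c') -> c = c'.
  move=> c4 c'4 m; have [Nk vk hk _] := kP c c4; have [Nk' vk' hk' _] := kP c' c'4.
  have kk : k c = k c' by apply: (@mid_uniq _ _ h1) => //; rewrite esym.
  have [Nv mv] := vP c c4; have [Nv' mv'] := vP c' c'4.
  by apply: v_inj => //; apply: (@mid_uniq _ _ (k c)); rewrite ?mv ?mv' // kk.
have k0 : k 0 = n0.
  have [Nk vk hk _] := kP 0 isT.
  by apply: (@meet_uniq z0 h1) => //; [rewrite eq_sym|rewrite esym].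
pose L m c := join (k m) (v c).
have LP m c : m < 4 -> c < 4 -> [/\ N (L m c), mid (L m c) = mid (k m), e (v c) (L m c) & par (L m c)].
  move=> m4 c4; have [Nk _ _ pk] := kP m m4; have [Nv _] := vP c c4.
  have [|NL mL Lv] := @joinP (k m) (v c) Nk Nv; first by rewrite pk v_par.
  by split=> //; [rewrite esym|rewrite (par_mid NL Nk mL)].
have L_diag m : m < 4 -> L m m = k m.
  move=> m4; have [NL mL vL _] := LP m m m4 m4; have [Nk vk _ _] := kP m m4; have [Nv _] := vP m m4.
  by apply: (@mid_uniq _ _ (v m)) => //; rewrite esym.
have L_inj m c c' : m < 4 -> c < 4 -> c' < 4 -> L m c = L m c' -> c = c'.
  move=> m4 c4 c'4 LL; have [NL _ vL _] := LP m c m4 c4; have [_ _ vL' _] := LP m c' m4 c'4.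
  have [Nv mv] := vP c c4; have [Nv' mv'] := vP c' c'4.
  by apply: v_inj => //; apply: (@mid_uniq _ _ (L m c)); rewrite ?mv ?mv' // LL.
have L00 : L 0 0 = n0 by rewrite L_diag.
(* The point (a, 0), where the line b = 0 meets the line of slope 1 and intercept [a]. *)
pose h a := meet n0 (L 1 a).
have hP a : a < 4 -> [/\ N (h a), e n0 (h a), e (L 1 a) (h a) & par (h a) = false].
  move=> a4; have [NL mL vL pL] := LP 1 a isT a4.
  have [||Nha nha Lha] := @meetP n0 (L 1 a) Nn NL; first by rewrite pn.
    by rewrite mL -k0; apply/negP => /eqP/k_mid => /(_ isT isT).
  by split=> //; rewrite (par_edge Nn Nha nha) pn.
have h_uniq a w : a < 4 -> N w -> e w n0 -> e w (L 1 a) -> h a = w.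
  move=> a4 Nw wn wL; have [NL mL _ _] := LP 1 a isT a4; have [Nha nha Lha _] := hP a a4.
  apply: (@meet_uniq n0 (L 1 a)) => //; rewrite 1?esym //.
  by apply/negP => /eqP nL; have := @k_mid 0 1 isT isT; rewrite k0 -mL -nL => /(_ erefl).
have h0 : h 0 = z0.
  by apply: h_uniq => //; have [] := LP 1 0 isT isT.
have h1E : h 1 = h1.
  by apply: h_uniq => //; [rewrite esym|rewrite L_diag //; have [] := kP 1 isT].
have h_mid a a' : a < 4 -> a' < 4 -> mid (h a) = mid (h a') -> a = a'.
  move=> a4 a'4 m; have [Nha nha Lha _] := hP a a4; have [Nha' nha' Lha' _] := hP a' a'4.
  have hh : h a = h a' by apply: (@mid_uniq _ _ n0) => //; rewrite esym.
  have [NL mL _ _] := LP 1 a isT a4; have [NL' mL' _ _] := LP 1 a' isT a'4.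
  by apply: (@L_inj 1) => //; apply: (@mid_uniq _ _ (h a)); rewrite ?mL ?mL' // hh.
pose P a b := join (h a) (L 0 b).
have PP a b : a < 4 -> b < 4 -> [/\ N (P a b), mid (P a b) = mid (h a), e (P a b) (L 0 b) & par (P a b) = false].
  move=> a4 b4; have [Nha _ _ pha] := hP a a4; have [NL _ _ pL] := LP 0 b isT b4.
  have [|NP mP Pv] := @joinP (h a) (L 0 b) Nha NL; first by rewrite pha pL.
  by split=> //; rewrite (par_mid NP Nha mP).
have P_uniq a b w : a < 4 -> b < 4 -> N w -> mid w = mid (h a) -> e w (L 0 b) -> P a b = w.
  move=> a4 b4 Nw mw wL; have [NP mP PL _] := PP a b a4 b4; have [NL _ _ _] := LP 0 b isT b4.
  by apply: (@mid_uniq _ _ (L 0 b)); rewrite ?mP ?mw.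
have P_inj a b b' : a < 4 -> b < 4 -> b' < 4 -> P a b = P a b' -> b = b'.
  move=> a4 b4 b'4 PE; have [NP _ PL _] := PP a b a4 b4; have [_ _ PL' _] := PP a b' a4 b'4.
  have [NL mL _ _] := LP 0 b isT b4; have [NL' mL' _ _] := LP 0 b' isT b'4.
  apply: (@L_inj 0) => //; apply: (@mid_uniq _ _ (P a b)); rewrite ?mL ?mL' // esym //.
  by rewrite PE.
have P_onto a w : a < 4 -> N w -> mid w = mid (h a) -> exists2 b, b < 4 & P a b = w.
  move=> a4 Nw mw; have [Nha _ _ _] := hP a a4.
  pose A := [set P a (b : 'I_4) | b : 'I_4].
  have cA : #|A| = 4.
    by rewrite card_imset ?card_ord // => b b' /P_inj bb; apply/val_inj/bb.
  have sub : A \subset [set w | N w & mid w == mid (h a)].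
    apply/subsetP => _ /imsetP[b _ ->]; have [NP mP _ _] := PP a b a4 (ltn_ord b).
    by rewrite inE NP mP /=.
  have /eqP AE : A == [set w | N w & mid w == mid (h a)] by rewrite eqEcard sub card_mid // cA.
  have : w \in A by rewrite AE inE Nw mw /=.
  by case/imsetP => b _ ->; exists b.
pose f m a c := find (fun b => e (P a b) (L m c)) (iota 0 4).
have fP m a c : m < 4 -> a < 4 -> c < 4 -> f m a c < 4 /\ e (P a (f m a c)) (L m c).
  move=> m4 a4 c4; have [Nha _ _ pha] := hP a a4; have [NL _ _ pL] := LP m c m4 c4.
  have [|NJ mJ JL] := @joinP (h a) (L m c) Nha NL; first by rewrite pha pL.
  have [b b4 PJ] := P_onto a _ a4 NJ mJ.
  have has_b : has (fun b => e (P a b) (L m c)) (iota 0 4).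
    by apply/hasP; exists b; rewrite ?mem_iota ?PJ.
  have f4 : f m a c < 4 by move: has_b; rewrite has_find size_iota.
  by split=> //; have := nth_find 0 has_b; rewrite nth_iota.
have f_uniq m a c b : m < 4 -> a < 4 -> c < 4 -> b < 4 -> e (P a b) (L m c) -> f m a c = b.
  move=> m4 a4 c4 b4 PL; have [f4 PfL] := fP m a c m4 a4 c4; have [NL _ _ _] := LP m c m4 c4.
  have [NP mP _ _] := PP a b a4 b4; have [NP' mP' _ _] := PP a _ a4 f4.
  by apply: (@P_inj a) => //; apply: (@mid_uniq _ _ (L m c)); rewrite ?mP ?mP'.
have fE : forall m a c, m < 4 -> a < 4 -> c < 4 -> f m a c = xor4 c (mul4 m a).
  apply: net_unique.
  - by move=> m a c m4 a4 c4; have [] := fP m a c m4 a4 c4.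
  - by move=> a c a4 c4; apply: f_uniq => //; have [] := PP a c a4 c4.
  - move=> m c m4 c4; apply: f_uniq => //; have [Nv mv] := vP c c4.
    rewrite (@P_uniq 0 c (v c)) //; [by have [] := LP m c m4 c4|by rewrite h0|by have [] := LP 0 c isT c4].
  - move=> a a4; apply: f_uniq => //; have [Nha nha Lha _] := hP a a4.
    by rewrite (@P_uniq a 0 (h a)) // ?L00 esym.
  - move=> m m4; apply: f_uniq => //; have [Nk _ hk _] := kP m m4.
    by rewrite (@P_uniq 1 0 h1) ?h1E ?L_diag ?k0 // esym.
  - move=> m a c c' m4 a4 c4 c'4 ff; have [f4 PL] := fP m a c m4 a4 c4; have [_ PL'] := fP m a c' m4 a4 c'4.
    have [NL mL _ _] := LP m c m4 c4; have [NL' mL' _ _] := LP m c' m4 c'4; have [NP _ _ _] := PP a _ a4 f4.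
    apply: (@L_inj m) => //; apply: (@mid_uniq _ _ (P a (f m a c))); rewrite ?mL ?mL' // esym //.
    by rewrite ff.
  move=> m m' a a' c c' m4 m'4 a4 a'4 c4 c'4 mm' E1 E2.
  have [f4 P1] := fP m a c m4 a4 c4; have [_ P2] := fP m' a c' m'4 a4 c'4.
  have [g4 P3] := fP m a' c m4 a'4 c4; have [_ P4] := fP m' a' c' m'4 a'4 c'4.
  have [NL mL _ _] := LP m c m4 c4; have [NL' mL' _ _] := LP m' c' m'4 c'4.
  have [N1 m1 _ _] := PP a _ a4 f4; have [N2 m2 _ _] := PP a' _ a'4 g4.
  have PE : P a (f m a c) = P a' (f m a' c).
    apply: (@meet_uniq (L m c) (L m' c')) => //; try by rewrite esym // ?E1 ?E2.
    by apply: contraNneq mm' => LE; apply/eqP/k_mid; rewrite -?mL -?mL' ?LE.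
  by apply: h_mid; rewrite // -m1 -m2 PE.
exists P, L; split=> [a b a4 b4|m c m4 c4|a b m c a4 b4 m4 c4].
- by have [-> _ _ ->] := PP a b a4 b4.
- by have [-> _ _ ->] := LP m c m4 c4.
rewrite -fE //; apply/idP/eqP => [/f_uniq -> //|->].
by have [] := fP m a c m4 a4 c4.
Qed.

End Coordinates.

End Net.

(** * An explicit subgraph on 97 vertices *)

Section Table.
Set Implicit Arguments. Unset Strict Implicit. Unset Printing Implicit Defensive.

(* Labels: 0 is the vertex x, 1 + 4a + b is the point (a, b), 17 + 4m + c is the line
   b = ma + c, and 33 + 16a + 4b + m is the vertex attached to the edge joining the point
   (a, b) with the line of slope m through it. *)
Definition net_adj i j :=
  let inc p l := ((p.-1 %% 4) == xor4 ((l - 17) %% 4) (mul4 ((l - 17) %/ 4) (p.-1 %/ 4))) in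
  [|| (i == 0) && (0 < j), (j == 0) && (0 < i),
      [&& 0 < i < 17, 17 <= j & inc i j] | [&& 0 < j < 17, 17 <= i & inc j i]].

Definition edge_point k := (k - 33) %/ 4 + 1.
Definition edge_line k :=
  let m := (k - 33) %% 4 in 17 + 4 * m + xor4 ((k - 33) %/ 4 %% 4) (mul4 m ((k - 33) %/ 16)).

(* The row of an edge vertex is 4 minus this combination of rows. *)
Definition combination k : seq (nat * nat) :=
  let p := edge_point k in let l := edge_line k in
  [:: (3, 0); (2, p); (2, l)] ++
  [seq (1, j) | j <- [seq j <- iota 1 32 | [&& j != p, j != l & net_adj p j || net_adj l j]]].

Arguments combination : simpl never.

(** Truncated subtraction is harmless, because only the value 1 is tested and the entry -2 at the
    vertex itself becomes 0. *)
Definition row_value (adj : nat -> nat -> bool) k j :=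
  4 + 2 * sumn [seq p.1 * (p.2 == j) | p <- combination k] - sumn [seq p.1 * adj p.2 j | p <- combination k].

(** Two stages: the combinations give the rows of the edge vertices on the 33 net vertices, and
    these values then serve as adjacencies when the same combinations are evaluated at edge
    vertices. *)
Definition adjacency_table : seq (seq bool) := Eval vm_compute in
  let N := mkseq (fun i => mkseq (net_adj i) 33) 33 in
  let inN i j := nth false (nth [::] N i) j in
  let S := mkseq (fun k => mkseq (fun j => row_value inN (k + 33) j == 1) 33) 64 in
  let inS j k := nth false (nth [::] S (k - 33)) j in
  mkseq (fun i => mkseq (fun j =>
    if i < 33 then if j < 33 then inN i j else inS i j
    else if j < 33 then inS j i else row_value inS i j == 1) 97) 97.

Definition table i j := nth false (nth [::] adjacency_table i) j.

Arguments table : simpl never.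

Lemma table_net : all (fun i => all (fun j => table i j == net_adj i j) (iota 0 33)) (iota 0 33).
Proof. by vm_compute. Qed.

Lemma table_sym : all (fun i => all (fun j => table i j == table j i) (iota 0 97)) (iota 0 97).
Proof. by vm_compute. Qed.

(** Distinct rows make any labelling that respects [table] on the net injective. *)
Lemma table_rows : all (fun i => all (fun j =>
  (i == j) || has (fun k => table i k != table j k) (iota 0 33)) (iota 0 33)) (iota 0 33).
Proof. by vm_compute. Qed.

Lemma combination_lt : all (fun k => all (fun p => p.2 < 33) (combination k)) (iota 33 64).
Proof. by vm_compute. Qed.

(** The negated combination falls under [virtual_vertex] with t = -2: weight -13 = -14 + 1 and
    [quad] = 2 + 8 - 56 = -46. *)
Lemma combination_quad : all (fun k => let s := combination k in
  (sumn (unzip1 s) == 13) &&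
  (sumn [seq p.1 * sumn [seq q.1 * table p.2 q.2 | q <- s] | p <- s] ==
   2 * sumn [seq p.1 * sumn [seq q.1 * (p.2 == q.2) | q <- s] | p <- s] + 46)) (iota 33 64).
Proof. by vm_compute. Qed.

Lemma combination_row : all (fun k => let s := combination k in all (fun j =>
  4 + 2 * sumn [seq p.1 * (p.2 == j) | p <- s] + 2 * (k == j) ==
  table k j + sumn [seq p.1 * table p.2 j | p <- s]) (iota 0 97)) (iota 33 64).
Proof. by vm_compute. Qed.

Lemma iota_allP m n (P : pred nat) i : all P (iota m n) -> m <= i < m + n -> P i.
Proof. by move=> /allP/(_ i); rewrite mem_iota. Qed.

Lemma tableE i j : i < 33 -> j < 33 -> table i j = net_adj i j.
Proof. by move=> i33 j33; apply/eqP; apply: (iota_allP (iota_allP table_net _)). Qed.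

Lemma tableC i j : i < 97 -> j < 97 -> table i j = table j i.
Proof. by move=> i97 j97; apply/eqP; apply: (iota_allP (iota_allP table_sym _)). Qed.

End Table.

(** * Realising the table inside $\Delta$ *)

Section Labelling.
Set Implicit Arguments. Unset Strict Implicit. Unset Printing Implicit Defensive.
Variables (V : finType) (e : rel V).
Hypotheses (simple_e : simple_graph e) (srg_e : srg e 105 32 4 12).
Variable x : V.
Hypothesis wheel : forall a b c d, e x a -> e x b -> e x c -> e x d ->
  e a b -> e b c -> e c d -> e d a -> a != c -> b = d.

Let esym := e_sym simple_e.
Let eirr := e_irr simple_e.

Lemma local_coordinates : exists P L : nat -> nat -> V,
  [/\ forall a b, a < 4 -> b < 4 -> e x (P a b), forall m c, m < 4 -> c < 4 -> e x (L m c),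
      forall a b a' b', a < 4 -> b < 4 -> a' < 4 -> b' < 4 -> e (P a b) (P a' b') = false,
      forall m c m' c', m < 4 -> c < 4 -> m' < 4 -> c' < 4 -> e (L m c) (L m' c') = false &
      forall a b m c, a < 4 -> b < 4 -> m < 4 -> c < 4 ->
        e (P a b) (L m c) = (b == xor4 c (mul4 m a))].
Proof.
have [z xz] : exists z, z \in [set z | e x z] by apply/set0Pn; rewrite -card_gt0 (card_nb srg_e).
rewrite inE in xz.
have [n] : exists n, n \in common e x z by apply/set0Pn; rewrite -card_gt0 (card_common4 srg_e).
rewrite in_common => /andP[xn zn].
have [h] : exists h, h \in common e x n :\ z.
  apply/set0Pn; rewrite -card_gt0.
  by have := cardsD1 z (common e x n); rewrite (card_common4 srg_e) //; lia.
rewrite in_setD1 in_common => /and3P[hz xh nh].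
have zz : opposed e x z z = false.
  by apply: (opp_cls simple_e srg_e); rewrite ?cls_refl.
have par_edge u v : e x u -> e x v -> e u v -> opposed e x z v = ~~ opposed e x z u.
  by move=> xu xv uv; apply: (opp_edge simple_e srg_e wheel).
have par_mid u v : e x u -> e x v -> mid e x u = mid e x v -> opposed e x z u = opposed e x z v.
  move=> xu xv m; have := opp_cls simple_e srg_e xu (w := v); rewrite inE xv m eqxx => /(_ isT).
  by rewrite (opp_trans simple_e srg_e wheel xz) // => /negbFE/eqP.
have [||||||P [L [NP NL PL]]] :=
  @net_coordinates V e (e x) (opposed e x z) (mid e x) esym par_edge par_mid _ _ _ _ _ z n h xz xn xh _ zn nh hz.
- by move=> u xu; exact: (card_cls simple_e srg_e wheel xu).
- by move=> u u' w xu xu' xw; exact: (cls_uniq simple_e srg_e xu xu' xw).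
- move=> u w xu xw uw; have [|v] := opp_join simple_e srg_e wheel xu xw.
    by rewrite (opp_trans simple_e srg_e wheel xz).
  by rewrite inE => /andP[xv /eqP mv] vw; exists v.
- by move=> u v xu xv; exact: (opp_meet simple_e srg_e wheel xz xu xv).
- by move=> a b u v xa xb ab xu xv; exact: (uniq_common simple_e wheel xa xb ab xu xv).
- by rewrite zz.
exists P, L; split=> // [a b a4 b4|m c m4 c4|a b a' b' a4 b4 a'4 b'4|m c m' c' m4 c4 m'4 c'4].
- by have /andP[] := NP a b a4 b4.
- by have /andP[] := NL m c m4 c4.
- have /andP[xP pP] := NP a b a4 b4; have /andP[xP' pP'] := NP a' b' a'4 b'4.
  by apply/negP => /(par_edge _ _ xP xP'); rewrite (negbTE pP) (negbTE pP').
have /andP[xP pP] := NL m c m4 c4; have /andP[xP' pP'] := NL m' c' m'4 c'4.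
by apply/negP => /(par_edge _ _ xP xP'); rewrite pP pP'.
Qed.

Lemma net_labelling : exists lab : nat -> V, lab 0 = x /\
  forall i j, i < 33 -> j < 33 -> e (lab i) (lab j) = table i j.
Proof.
have [P [L [xP xL PP LL PL]]] := local_coordinates.
pose lab i := if i == 0 then x else if i < 17 then P (i.-1 %/ 4) (i.-1 %% 4) else L ((i - 17) %/ 4) ((i - 17) %% 4).
exists lab; split=> // i j i33 j33; rewrite tableE // /lab /net_adj.
have q4 (k : nat) : k < 16 -> k %/ 4 < 4 by move=> k16; rewrite ltn_divLR.
case: eqVneq => [->|i0] /=; case: eqVneq => [->|j0] /=; rewrite ?eirr ?lt0n ?i0 ?j0 //=.
- by case: (ltnP j 17) => j17; [apply: xP|apply: xL]; rewrite ?ltn_mod // q4 //; lia.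
- case: (ltnP i 17) => i17; rewrite esym; [apply: xP|apply: xL]; rewrite ?ltn_mod // q4 //; lia.
case: (ltnP i 17) => i17; case: (ltnP j 17) => j17 /=.
- rewrite PP ?ltn_mod ?q4 //; lia.
- rewrite PL ?ltn_mod ?q4 // ?orbF; lia.
- rewrite esym PL ?ltn_mod ?q4 //; lia.
- rewrite LL ?ltn_mod ?q4 //; lia.
Qed.

Lemma sumn_int (T : Type) (F : T -> nat) s :
  ((sumn [seq F p | p <- s])%:R = \sum_(p <- s) (F p)%:R :> int)%R.
Proof. by rewrite sumnE big_map natr_sum. Qed.

Lemma labelling : exists lab : nat -> V, lab 0 = x /\ forall i j, i < 97 -> j < 97 ->
  e (lab i) (lab j) = table i j /\ (lab i == lab j) = (i == j).
Proof.
have [net [net0 netE]] := net_labelling.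
have net_inj i j : i < 33 -> j < 33 -> (net i == net j) = (i == j).
  move=> i33 j33; apply/eqP/eqP => [eq_ij|-> //]; apply/eqP.
  have /orP[//|/hasP[k]] := iota_allP (iota_allP table_rows i33) j33.
  by rewrite mem_iota => k33; rewrite -!netE ?eq_ij ?eqxx.
pose l k := [seq (- p.1%:R : int, net p.2) | p <- combination k].
pose row k w := (rowsum e (l k) w + 4%:R)%R.
have comb_lt k p : 33 <= k < 97 -> p \in combination k -> p.2 < 33.
  by move=> k97; apply/allP: p; exact: (iota_allP combination_lt k97).
pose y k := odflt x [pick y | [forall w, adj e y w - 2%:R * delta y w == row k w]]%R.
have yP k w : 33 <= k < 97 -> (adj e (y k) w - 2%:R * delta (y k) w = row k w)%R.
  move=> k97; rewrite /y; case: pickP => [v /forallP/(_ w)/eqP //|none].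
  have /andP[/eqP W /eqP Q] := iota_allP combination_quad k97.
  have [||v vP] := @virtual_vertex _ _ simple_e srg_e (l k) (- 2%:R)%R.
  - have -> : weight (l k) = (- (sumn (unzip1 (combination k)))%:R)%R.
      by rewrite /weight big_map (sumn_int fst) -sumrN.
    by rewrite W.
  - pose s := combination k; rewrite -/s in Q.
    have -> : quad e (l k) =
        (2%:R * (sumn [seq p.1 * sumn [seq q.1 * (p.2 == q.2) | q <- s] | p <- s])%N%:R
         - (sumn [seq p.1 * sumn [seq q.1 * table p.2 q.2 | q <- s] | p <- s])%N%:R)%R.
      rewrite /quad big_map (sumn_int (fun p => p.1 * sumn [seq q.1 * table p.2 q.2 | q <- s])%N).
      rewrite (sumn_int (fun p => p.1 * sumn [seq q.1 * (p.2 == q.2) | q <- s])%N).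
      rewrite mulr_sumr -sumrB; apply: eq_big_seq => p pk.
      rewrite big_map !natrM (sumn_int (fun q => q.1 * table p.2 q.2)%N).
      rewrite (sumn_int (fun q => q.1 * (p.2 == q.2))%N) !mulr_sumr -sumrB; apply: eq_big_seq => q qk /=.
      rewrite /adj /delta netE ?net_inj ?(comb_lt k) // !natrM; ring.
    by rewrite Q; lia.
  by have := none v; rewrite (introT forallP) // => w'; apply/eqP; rewrite -vP /row; ring.
pose lab k := if k < 33 then net k else y k.
have rowE k j : 33 <= k < 97 -> j < 97 ->
    (forall p, p \in combination k -> e (net p.2) (lab j) = table p.2 j /\ (net p.2 == lab j) = (p.2 == j)) ->
    (adj e (lab k) (lab j) - 2%:R * delta (lab k) (lab j) = (table k j)%:R - 2%:R * (k == j)%:R)%R.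
  move=> k97 j97 comb_j; rewrite {1 3}/lab ltnNge; have /andP[-> _] /= := k97; rewrite yP //.
  have /eqP tab := iota_allP (iota_allP combination_row k97) j97.
  have -> : row k (lab j) = (2%:R * (sumn [seq p.1 * (p.2 == j) | p <- combination k])%N%:R
       - (sumn [seq p.1 * table p.2 j | p <- combination k])%N%:R + 4%:R)%R.
    rewrite /row /rowsum big_map (sumn_int (fun p => p.1 * table p.2 j)%N).
    rewrite (sumn_int (fun p => p.1 * (p.2 == j))%N) mulr_sumr -sumrB; congr (_ + _)%R.
    apply: eq_big_seq => p pk; have [ep dp] := comb_j p pk.
    by rewrite /adj /delta /= ep dp !natrM; ring.
  by move: tab; move: (sumn _) (sumn _) => s1 s2; lia.
have yE k j : 33 <= k < 97 -> j < 97 ->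
    (forall p, p \in combination k -> e (net p.2) (lab j) = table p.2 j /\ (net p.2 == lab j) = (p.2 == j)) ->
    e (lab k) (lab j) = table k j /\ (lab k == lab j) = (k == j).
  move=> k97 j97 /(rowE k j k97 j97); have [->|kj] := eqVneq k j.
    by rewrite /adj /delta eirr !eqxx; case: (table j j) => /=; lia.
  rewrite mulr0 subr0 => /(row_ge0 simple_e)[/negbTE -> ->]; by case: (table k j).
(* Adjacencies between edge vertices and the net come first. They are then the data needed to
   evaluate the row of one edge vertex at another. *)
have small k j : 33 <= k < 97 -> j < 33 -> e (lab k) (lab j) = table k j /\ (lab k == lab j) = (k == j).
  move=> k97 j33; apply: yE => // [|p pk]; first by lia.
  by rewrite /lab j33 netE ?net_inj ?(comb_lt k).
exists lab; split=> [//|i j i97 j97].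
case: (ltnP i 33) => i33; case: (ltnP j 33) => j33.
- by rewrite /lab i33 j33 netE ?net_inj.
- have [|ji dji] := small j i _ i33; first by rewrite j33.
  by split; [rewrite esym ji tableC|rewrite eq_sym dji eq_sym].
- by apply: small => //; rewrite i33.
have i97' : 33 <= i < 97 by rewrite i33.
have j97' : 33 <= j < 97 by rewrite j33.
apply: yE => // p pi; have p33 := comb_lt i p i97' pi.
have [jp djp] := small j p.2 j97' p33; have -> : net p.2 = lab p.2 by rewrite /lab p33.
split; first by rewrite esym jp tableC //; lia.
by rewrite eq_sym djp eq_sym.
Qed.

End Labelling.

(** * Common neighbours in the cover *)

Section Distance.
Set Implicit Arguments. Unset Strict Implicit. Unset Printing Implicit Defensive.
Variables (T : finType) (e : rel T).

Lemma ball_mono x n m : n <= m -> ball e n x \subset ball e m x.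
Proof.
move=> /subnK <-; elim: (m - n) => [|k IHk]; first exact: subxx.
by apply: (subset_trans IHk); apply: subsetUl.
Qed.

(** [dist] tries only radii below #|T| and defaults to #|T|, whence the bound on [n]; [card_W]
    supplies it for the radii below 6 that occur. *)
Lemma dist_ball x y n : n < #|T| -> (y \in ball e n x) = (dist e x y <= n).
Proof.
move=> nT; rewrite /dist; set d := find _ _; apply/idP/idP => [yn|dn].
  rewrite leqNgt; apply/negP => /(before_find 0); rewrite nth_iota // add0n => /negbT.
  by rewrite yn.
apply: (subsetP (ball_mono x dn)).
have dT : d < size (iota 0 #|T|) by rewrite size_iota (leq_ltn_trans dn).
have := dT; rewrite -has_find => /(nth_find 0); rewrite -/d nth_iota //.
by rewrite size_iota in dT.
Qed.

Lemma in_ballS x y n : (y \in ball e n.+1 x) = (y \in ball e n x) || [exists z in ball e n x, e z y].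
Proof. by rewrite /= !inE. Qed.

Lemma ball_step x y z n : y \in ball e n x -> e y z -> z \in ball e n.+1 x.
Proof. by move=> yn yz; rewrite in_ballS; apply/orP; right; apply/exists_inP; exists y. Qed.

Lemma dist_diameter x y : dist e x y <= diameter e.
Proof.
apply: (@leq_trans (\max_(y : T) dist e x y)); first exact: (@leq_bigmax _ (fun y => dist e x y)).
exact: (@leq_bigmax _ (fun x => \max_(y : T) dist e x y)).
Qed.

End Distance.

(** * Edges at distance 2 from a vertex *)

Section ShortCorner.
Set Implicit Arguments. Unset Strict Implicit. Unset Printing Implicit Defensive.
Variables (V : finType) (e : rel V).
Hypotheses (simple_e : simple_graph e) (srg_e : srg e 105 32 4 12).

(* Otherwise the difference f of the indicators of the two sets of common neighbours would
   satisfy f . A f >= 64 by counting, while sum_sqr gives f . A f <= 48. *)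
Lemma far_edge_meets x y y' : x != y -> ~~ e x y -> x != y' -> ~~ e x y' -> e y y' ->
  exists z z', [/\ e x z, e y z, e x z', e y' z' & (z == z') || e z z'].
Proof.
move=> xy nxy xy' nxy' yy'.
pose S := [set z | e x z & e y z]; pose S' := [set z | e x z & e y' z].
have [|none] := boolP [exists z in S, exists z' in S', (z == z') || e z z'].
  case/exists_inP => z; rewrite inE => /andP[xz yz] /exists_inP[z'].
  by rewrite inE => /andP[xz' yz'] zz'; exists z, z'.
have sep z z' : z \in S -> z' \in S' -> z != z' /\ e z z' = false.
  move=> zS zS'; have : ~~ ((z == z') || e z z').
    apply: contra none => zz'; apply/exists_inP; exists z => //.
    by apply/exists_inP; exists z'.
  by rewrite negb_or => /andP[? /negbTE].
have cS : #|S| = 12 by exact: (card_common_far srg_e).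
have cS' : #|S'| = 12 by exact: (card_common_far srg_e).
have SS' : S :&: S' = set0.
  apply/setP => z; rewrite in_setI [RHS]inE; apply/negP => /andP[zS zS'].
  by have [] := sep z z zS zS'; rewrite eqxx.
pose A := S :|: S'; pose N := [set z | e x z]; pose C := N :\: A.
have AN : A \subset N by apply/subsetP => z; rewrite !inE => /orP[]/andP[].
have cA : #|A| = 24 by rewrite cardsU SS' cards0 cS cS'.
have cC : #|C| = 8 by rewrite cardsD (setIidPr AN) cA (card_nb srg_e).
have nbA a : a \in A -> e x a by move/(subsetP AN); rewrite inE.
have nbC a : a \in C -> e x a by rewrite !inE => /andP[].
have out : \sum_(a in A) #|common e x a :&: C| <= 32.
  rewrite (edge_count simple_e nbA nbC); apply: (@leq_trans (\sum_(c in C) 4)).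
    apply: leq_sum => c cc; rewrite -(card_common4 srg_e (nbC c cc)).
    by apply: subset_leq_card; apply: subsetIl.
  by rewrite sum_nat_const cC.
have total : \sum_(a in A) #|common e x a :&: A| + \sum_(a in A) #|common e x a :&: C| = 96.
  rewrite -big_split /= (eq_bigr (fun _ => 4)) ?sum_nat_const ?cA // => a aA.
  rewrite -(card_common4 srg_e (nbA a aA)) -(cardsID A (common e x a)); congr (_ + #|pred_of_set _|).
  by apply/setP => z; rewrite /C /N !inE; case: (e x z); rewrite ?andbF ?andbT //= andbC.
pose f z : int := ((z \in S)%:R - (z \in S')%:R)%R.
have sum_f : (\sum_z f z = 0)%R.
  have cnt (B : {set V}) : (\sum_z (z \in B)%:R = #|B|%:R :> int)%R.
    by rewrite sum_bool; congr (_%:R)%R; apply: eq_card => z; rewrite inE.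
  by rewrite sumrB !cnt cS cS' subrr.
have sq_f : (\sum_z f z ^+ 2 = 24%:R)%R.
  transitivity (\sum_z (z \in A)%:R : int)%R; last first.
    by rewrite sum_bool -cA; congr (_%:R)%R; apply: eq_card => z; rewrite inE.
  apply: eq_bigr => z _; rewrite /f /A in_setU; case zS: (z \in S); case zS': (z \in S') => //.
  by have [] := sep z z zS zS'; rewrite eqxx.
have prod_f : (\sum_z f z * nbsum e f z = (\sum_(a in A) #|common e x a :&: A|)%N%:R)%R.
  rewrite natr_sum [RHS]big_mkcond /=; apply: eq_bigr => a _.
  case aA: (a \in A); last first.
    by move: aA; rewrite /f /A in_setU => /norP[/negbTE -> /negbTE ->]; rewrite subrr mul0r.
  rewrite mulr_sumr; transitivity (\sum_b ((b \in A) && e a b)%:R : int)%R; last first.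
    rewrite sum_bool; congr (_%:R)%R; apply: eq_card => b; rewrite !inE.
    by case: (e x b); rewrite ?andbF //= andbC.
  apply: eq_bigr => b _; rewrite /f /adj /A in_setU; move: aA; rewrite /A in_setU.
  case aS: (a \in S); case aS': (a \in S') => //= _.
  - by have [] := sep a a aS aS'; rewrite eqxx.
  - case bS: (b \in S); case bS': (b \in S') => /=; rewrite ?subrr ?mulr0 ?mul0r //.
    + by have [] := sep b b bS bS'; rewrite eqxx.
    + by case: (e a b).
    + by have [_ ->] := sep a b aS bS'.
  case bS: (b \in S); case bS': (b \in S') => /=; rewrite ?subrr ?mulr0 ?mul0r //.
  + by have [] := sep b b bS bS'; rewrite eqxx.
  + by have [_ ba] := sep b a bS aS'; rewrite (e_sym simple_e) ba.
  + by case: (e a b).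
have : (0 <= \sum_z (nbsum e f z - 2%:R * f z) ^+ 2 :> int)%R by apply: sumr_ge0 => z _; exact: sqr_ge0.
rewrite (sum_sqr simple_e srg_e) sum_f sq_f prod_f => ge0.
by move: ge0 total out; move: (\sum_(a in A) _) (\sum_(a in A) _) => s1 s2; lia.
Qed.

End ShortCorner.

(** * Unique lifts and distances in the cover *)

Section Cover.
Set Implicit Arguments. Unset Strict Implicit. Unset Printing Implicit Defensive.
Variables (V W : finType) (e : rel V) (g : rel W) (F : W -> V).
Hypotheses (simple_e : simple_graph e) (srg_e : srg e 105 32 4 12).
Hypotheses (simple_g : simple_graph g) (dr_g : distance_regular g).
Hypothesis antipodal : antipodal_r_cover g e F 6.

Let eC := e_sym simple_e.
Let eirr := e_irr simple_e.
Let gC := e_sym simple_g.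

Lemma cover_edge u w : g u w -> e (F u) (F w).
Proof.
have [[[_ [cocl [nonadj _]]] _] _] := antipodal; move=> uw; apply: contraTT uw => nuw.
have [eqF|neF] := eqVneq (F u) (F w).
  by apply: (cocl (F u)); rewrite inE // eqF.
by apply: (nonadj _ _ neF nuw); rewrite !inE eqxx ?orbT.
Qed.

Lemma lift_ex u b : e (F u) b -> exists2 w, g u w & F w = b.
Proof.
have [[[_ [_ [_ [matching _]]]] _] _] := antipodal; move=> ub.
have := matching _ _ ub u; rewrite !inE eqxx => /(_ isT)/eqP/cards1P[w /setP/(_ w)].
rewrite !inE eqxx => /andP[wub uw]; exists w => //; apply/eqP.
by case/orP: wub => // /eqP Fw; have := cover_edge uw; rewrite Fw eirr.
Qed.

Lemma lift_uniq u w w' : g u w -> g u w' -> F w = F w' -> w = w'.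
Proof.
have [[[_ [_ [_ [matching _]]]] _] _] := antipodal; move=> uw uw' ww'.
have := matching _ _ (cover_edge uw) u; rewrite !inE eqxx => /(_ isT)/eqP/cards1P[v /setP Ev].
have := Ev w; have := Ev w'; rewrite !inE ww' eqxx uw uw' !orbT.
by move=> /esym/eqP -> /esym/eqP ->.
Qed.

(** Over a triangle the edges stay inside the blocks, so the path [u], [a], [b] lies in a single
    block, which is a clique. *)
Lemma triangle_lift u a b : g u a -> g a b -> e (F u) (F b) -> g u b.
Proof.
have [[[_ [_ [_ [_ triangles]]]] _] _] := antipodal; move=> ua ab ub.
have [P [/and3P[/eqP coverP trivP _] [clique block]]] := triangles _ _ _ (cover_edge ua) (cover_edge ab) ub.
set S := _ :|: _ in coverP block.
have [uS aS bS] : [/\ u \in S, a \in S & b \in S] by rewrite /S !inE !eqxx !orbT.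
have uP : pblock P u \in P by rewrite pblock_mem // coverP.
have [_ cl] := clique _ uP; apply: cl.
- by rewrite mem_pblock coverP.
- by rewrite (block u a) // (block a b) // mem_pblock coverP.
- by apply: contraTneq ub => ->; rewrite eirr.
Qed.

Lemma fibre_card v : #|fibre F v| = 6.
Proof. by have [[_ c6] _] := antipodal. Qed.

Lemma card_W n : n < 6 -> n < #|W|.
Proof.
move=> n6; apply: leq_trans n6 _; have [w _] : exists w : W, true.
  have [x _] : exists x : V, x \in [set: V].
    by apply/set0Pn; rewrite -card_gt0 cardsT; have [-> _] := srg_e.
  have : 0 < #|fibre F x| by rewrite fibre_card.
  by case/card_gt0P => w _; exists w.
by rewrite -(fibre_card (F w)) max_card.
Qed.

Definition close u w := [exists n, g u n && g n w].
Definition apart u w := (F u != F w) && ~~ e (F u) (F w).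

Lemma ball1 u w : (w \in ball g 1 u) = (u == w) || g u w.
Proof.
rewrite in_ballS inE eq_sym; congr (_ || _); apply/exists_inP/idP => [[z]|uw].
  by rewrite inE => /eqP ->.
by exists u; rewrite ?inE.
Qed.

Lemma apart_neq u w : apart u w -> u != w /\ g u w = false.
Proof.
case/andP => Fn en; split; first by apply: contraNneq Fn => ->.
by apply: contraNF en => /cover_edge.
Qed.

Lemma dist_le1 u w : (dist g u w <= 1) = (u == w) || g u w.
Proof. by rewrite -dist_ball ?card_W // ball1. Qed.

Lemma dist_apart u w : apart u w -> (dist g u w == 2) = close u w.
Proof.
move=> ap; have [un gn] := apart_neq ap.
rewrite eqn_leq (ltnNge 1) dist_le1 (negbTE un) gn andbT -dist_ball ?card_W // in_ballS ball1.
rewrite (negbTE un) gn /=; apply/exists_inP/existsP => -[z].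
  rewrite ball1 => /orP[/eqP <-|uz zw]; first by rewrite gn.
  by exists z; rewrite uz.
by case/andP => uz zw; exists z; rewrite // ball1 uz orbT.
Qed.

Lemma dist_eq1 u w : (dist g u w == 1) = g u w.
Proof.
rewrite eqn_leq dist_le1 ltnNge -dist_ball ?card_W // /= inE.
case: (eqVneq w u) => [->|_] /=; rewrite ?andbT ?andbF //.
by have [_ /(_ u)] := simple_g.
Qed.

Lemma close_number : exists c2, forall u w, apart u w -> close u w ->
  #|[set n | g u n & g n w]| = c2.
Proof.
have [_ [b [c bc]]] := dr_g; exists (c 2) => u w ap; rewrite -dist_apart // => /eqP d2.
have [_] := bc u w; rewrite d2 => /(_ isT) <-; apply: eq_card => n.
by rewrite !inE /= dist_eq1 [g w n]gC andbC.
Qed.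

(** Each of the 12 common neighbours downstairs lifts to one neighbour of [u], which in turn has one
    neighbour over [y]. Grouping by the latter splits the 12 into parts of size [c2]. *)
Lemma close_count u y c2 : F u != y -> ~~ e (F u) y ->
  (forall w, apart u w -> close u w -> #|[set n | g u n & g n w]| = c2) ->
  12 = #|[set w | (F w == y) && close u w]| * c2.
Proof.
move=> uy nuy cst; rewrite -(card_common_far srg_e uy nuy) -sum_nat_const.
pose A := [set n | g u n & e (F n) y].
have -> : #|[set z | e (F u) z & e y z]| = #|A|.
  have -> : [set z | e (F u) z & e y z] = F @: A.
    apply/setP => z; rewrite inE; apply/andP/imsetP => [[uz yz]|[n]].
      by have [n un Fn] := lift_ex uz; exists n; rewrite // inE un Fn eC.
    by rewrite inE => /andP[/cover_edge un ny] ->; rewrite eC in ny.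
  by rewrite card_in_imset // => n n'; rewrite !inE => /andP[un _] /andP[un' _]; exact: (lift_uniq un un').
pose h n := odflt u [pick w | g n w && (F w == y)].
have hP n : n \in A -> g n (h n) /\ F (h n) = y.
  rewrite inE => /andP[_ /lift_ex[w nw Fw]]; rewrite /h; case: pickP => [v /andP[-> /eqP] //|/(_ w)].
  by rewrite nw Fw eqxx.
rewrite -sum1_card (partition_big h (fun w => (F w == y) && close u w)) => [|n nA].
  apply: eq_big => [w|w /andP[/eqP Fw cl]]; first by rewrite inE.
  have ap : apart u w by rewrite /apart Fw uy.
  rewrite sum1dep_card -(cst w ap cl); apply: eq_card => n; rewrite !inE.
  apply/andP/andP => [[/andP[un ny] /eqP hn]|[un nw]].
    by have [] := hP n; rewrite ?inE ?un // hn.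
  have ny : e (F n) y by rewrite -Fw cover_edge.
  rewrite un ny; split=> //; have [|nh Fh] := hP n; first by rewrite inE un.
  by apply/eqP/(@lift_uniq n) => //; rewrite Fh Fw.
have [nh Fh] := hP n nA; rewrite Fh eqxx /=; apply/existsP; exists n.
by move: nA; rewrite inE nh => /andP[->].
Qed.

(** A path of length 2 between fibre mates contradicts unique lifting; one of length 3 lies over a
    triangle and is shortened by [triangle_lift] to length 2. *)
Lemma mate_dist u u' : F u = F u' -> u != u' -> dist g u u' = diameter g /\ 3 < dist g u u'.
Proof.
have [_ [_ anti]] := antipodal; move=> FF uu'.
have := anti u u'; rewrite FF eqxx (negbTE uu') /= => /eqP d; split=> //.
have no2 v a w : g v a -> g a w -> F v = F w -> v = w.
  by move=> va aw; apply: (@lift_uniq a); rewrite // gC.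
rewrite ltnNge -dist_ball ?card_W // !in_ballS !inE [u' == u]eq_sym (negbTE uu') /=.
have no1 : g u u' = false by apply/negP => /cover_edge; rewrite FF eirr.
have B2 z : (z \in ball g 2 u) -> [\/ z = u, g u z | exists2 a, g u a & g a z].
  rewrite in_ballS ball1 => /orP[/orP[/eqP ->|uz]|/exists_inP[a]]; [by constructor|by constructor|].
  by rewrite ball1 => /orP[/eqP <-|ua] az; [constructor 2|constructor 3; exists a].
apply/negP => /orP[/orP[/exists_inP[z]|/exists_inP[z]]|/exists_inP[z]].
- by rewrite inE => /eqP ->; rewrite no1.
- rewrite ball1 => /orP[/eqP <-|uz] zu'; first by rewrite no1 in zu'.
  by case/eqP: uu'; apply: no2 uz zu' FF.
move=> /B2[->|uz|[a ua az]] zu'; first by rewrite no1 in zu'.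
  by case/eqP: uu'; apply: no2 uz zu' FF.
have uz : g u z by apply: (triangle_lift ua az); rewrite FF eC cover_edge.
by case/eqP: uu'; apply: no2 uz zu' FF.
Qed.

(* Two close vertices in one fibre bound the diameter by 4; then no vertex over a nonadjacent
   fibre can be at distance 3, as it would have a neighbour at distance 4, that is, in the
   fibre it is not adjacent to. *)
Lemma folded_close u w w' : apart u w -> F w = F w' -> w != w' -> close u w -> close u w' ->
  forall p q, apart p q -> close p q.
Proof.
move=> ap ww' neq /existsP[n /andP[un nw]] /existsP[n' /andP[un' nw']].
have [dD d3] := mate_dist ww' neq.
have w4 : w' \in ball g 4 w.
  have w0 : w \in ball g 0 w by rewrite inE.
  have w1 := ball_step w0 (etrans (gC w n) nw); have w2 := ball_step w1 (etrans (gC n u) un).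
  exact: ball_step (ball_step w2 un') nw'.
have d4 : dist g w w' = 4 by apply/eqP; rewrite eqn_leq d3 andbT -dist_ball ?card_W.
have D4 : diameter g = 4 by rewrite -dD.
have [_ [b [c bc]]] := dr_g.
have b3 : 0 < b 3.
  move: w4; rewrite in_ballS dist_ball ?card_W // d4 /= => /exists_inP[z z3 zw'].
  have dz : dist g w z = 3.
    apply/eqP; rewrite eqn_leq -dist_ball ?card_W // z3 /= ltnNge -dist_ball ?card_W //.
    by apply/negP => z2; have := ball_step z2 zw'; rewrite dist_ball ?card_W // d4.
  have [bE _] := bc w z; rewrite dz in bE; rewrite -bE; apply/card_gt0P; exists w'.
  by rewrite inE zw' d4.
move=> p q pq; have [pq0 pq1] := apart_neq pq; rewrite -dist_apart //.
have [_ [_ anti]] := antipodal.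
have := dist_diameter g p q; rewrite D4; have := dist_le1 p q; rewrite (negbTE pq0) pq1 /=.
have [Fpq npq] := andP pq.
have n4 : dist g p q != 4 by have := anti p q; rewrite (negbTE Fpq) D4 => /negbT/norP[].
suff n3 : dist g p q != 3 by case: (dist g p q) n3 n4 => [|[|[|[|[|]]]]].
apply/negP => /eqP d; have [bE _] := bc p q; rewrite d in bE.
move: b3; rewrite -bE => /card_gt0P[z]; rewrite inE => /andP[qz /eqP pz].
by have := anti p z; rewrite pz D4 eqxx orbT => /esym/eqP Fz; move: npq; rewrite Fz eC cover_edge.
Qed.

(* Otherwise u, its neighbours and the close vertices would be closed under adjacency. *)
Lemma close_not_uniq : exists u w w', [/\ apart u w, F w = F w', w != w', close u w & close u w'].
Proof.
have [|none] := boolP [exists u, exists w, exists w', [&& apart u w, F w == F w', w != w', close u w & close u w']].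
  by case/existsP => u /existsP[w /existsP[w' /and5P[? /eqP ? ? ? ?]]]; exists u, w, w'.
have uniq u w w' : apart u w -> F w = F w' -> close u w -> close u w' -> w = w'.
  move=> ap ww' cw cw'; apply/eqP; apply: contraT => neq; case/negP: none.
  apply/existsP; exists u; apply/existsP; exists w; apply/existsP; exists w'.
  by rewrite ap ww' eqxx neq cw cw'.
(* Under the uniqueness assumption every common neighbour of the projections lifts to a common
   neighbour: its lift next to [u] has a neighbour over [F t], which is close to [u] and so equals
   [t]. *)
have corner u t z : apart u t -> close u t -> e (F u) z -> e (F t) z ->
    exists m, [/\ g u m, F m = z & g m t].
  move=> ap cl uz tz; have [m um Fm] := lift_ex uz.
  have [|t' mt' Ft'] := @lift_ex m (F t); first by rewrite Fm eC.
  exists m; split=> //; rewrite (uniq u t t') //; apply/existsP; exists m.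
  by rewrite um.
have [v _] : exists v : V, v \in [set: V].
  by apply/set0Pn; rewrite -card_gt0 cardsT; have [-> _] := srg_e.
have : 1 < #|fibre F v| by rewrite fibre_card.
case/card_gt1P => u [u' [+ + uu']]; rewrite !inE => /eqP Fu /eqP Fu'.
pose C := [pred w | [|| w == u, g u w | apart u w && close u w]].
have step t s : g t s -> t \in C -> s \in C.
  move=> ts; rewrite !inE => tC; have es := cover_edge ts.
  case Fus: (F u == F s).
    case/or3P: tC => [/eqP tu|ut|/andP[/andP[_ +] _]].
    - by rewrite -tu ts orbT.
    - by rewrite (@lift_uniq t s u) ?eqxx // 1?gC // (eqP Fus).
    by rewrite (eqP Fus) eC es.
  case eus: (e (F u) (F s)).
    suff -> : g u s by rewrite orbT.
    case/or3P: tC => [/eqP <- //|ut|/andP[ap cl]]; first exact: (triangle_lift ut ts).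
    have [m [um Fm mt]] := corner u t (F s) ap cl eus es.
    by rewrite (@lift_uniq t s m) // gC.
  have ap : apart u s by rewrite /apart Fus eus.
  rewrite ap; suff -> : close u s by rewrite !orbT.
  case/or3P: tC => [/eqP tu|ut|/andP[apt clt]].
  - by move: eus; rewrite -tu es.
  - by apply/existsP; exists t; rewrite ut.
  have through z : e (F u) z -> e (F t) z -> e (F s) z -> close u s.
    move=> uz tz sz; have [m [um Fm mt]] := corner u t z apt clt uz tz.
    by apply/existsP; exists m; rewrite um (triangle_lift mt ts) // Fm eC.
  have [ut nut] := andP apt.
  (* The hard case: [t] is close to [u], and [F t], [F s] are both nonadjacent to [F u]. The
     vertices over [z'] next to [u] and next to [s] are both close to [t], so they coincide and give
     a common neighbour of [u] and [s]. *)
  have [z [z' [uz tz uz' sz' zz']]] := far_edge_meets simple_e srg_e ut nut (negbT Fus) (negbT eus) es.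
  case/orP: zz' => [/eqP zz'|zz']; first by apply: (through z) => //; rewrite zz'.
  case tz': (e (F t) z'); first exact: (through z').
  have [m [um Fm mt]] := corner u t z apt clt uz tz; have [m' um' Fm'] := lift_ex uz'.
  have mm' : g m m' by apply: (@triangle_lift m u m'); rewrite ?Fm ?Fm' // gC.
  have [s' ss' Fs'] := lift_ex sz'.
  have m's' : m' = s'.
    apply: (uniq t).
    - by rewrite /apart Fm' tz' andbT; apply: contraNneq nut => ->.
    - by rewrite Fm'.
    - by apply/existsP; exists m; rewrite gC mt.
    - by apply/existsP; exists s; rewrite ts.
  by apply/existsP; exists m'; rewrite um' m's' gC.
have [con _] := dr_g; have gsc : connect_sym g by apply: sym_connect_sym; have [] := simple_g.
have := closed_connect (intro_closed gsc step) (con u u'); rewrite !inE eqxx /= => /esym/or3P[].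
- by rewrite eq_sym (negbTE uu').
- by move/cover_edge; rewrite Fu Fu' eirr.
- by rewrite /apart Fu Fu' eqxx.
Qed.

(** All six vertices of the fibre are close to [u], so [close_count] reads 12 = 6 c2. *)
Lemma card_corner u w : apart u w -> #|[set n | g u n & g n w]| = 2.
Proof.
move=> ap; have [a [b [b' [ab bb' neq clb clb']]]] := close_not_uniq.
have all_close := folded_close ab bb' neq clb clb'.
have [c2 cst] := close_number; rewrite (cst u w ap (all_close _ _ ap)).
have [Fn en] := andP ap; have := close_count Fn en (cst u).
have -> : [set v | (F v == F w) && close u v] = fibre F (F w).
  apply/setP => v; rewrite !inE; case: eqP => //= Fv.
  by apply: all_close; rewrite /apart Fv.
by rewrite fibre_card; lia.
Qed.

Lemma no_three_corner u w n1 n2 n3 : apart u w -> n1 != n2 -> n1 != n3 -> n2 != n3 ->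
  g u n1 -> g n1 w -> g u n2 -> g n2 w -> g u n3 -> g n3 w -> False.
Proof.
move=> ap n12 n13 n23 u1 w1 u2 w2 u3 w3.
have : #|[set n1; n2; n3]| <= #|[set n | g u n & g n w]|.
  by apply: subset_leq_card; apply/subsetP => n; rewrite !inE -orbA => /or3P[]/eqP ->; apply/andP.
by rewrite card_corner // -setUA !cardsU1 !inE cards1 (negbTE n12) (negbTE n13) (negbTE n23).
Qed.

(** The wheel lifts around a vertex [u] over [x]; if [b] and [d] differ, the lifts of [a] and [c]
    have the three common neighbours [u], [b'], [d']. *)
Lemma cover_wheel x a b c d : e x a -> e x b -> e x c -> e x d ->
  e a b -> e b c -> e c d -> e d a -> a != c -> b = d.
Proof.
move=> xa xb xc xd ab bc cd da ac; apply: contraTeq isT => bd.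
have [[[surj _] _] _] := antipodal; have [u Fu] := surj x.
have lift v : e x v -> exists2 w, g u w & F w = v by rewrite -Fu; exact: lift_ex.
have [a' ua Fa] := lift a xa; have [b' ub Fb] := lift b xb.
have [c' uc Fc] := lift c xc; have [d' ud Fd] := lift d xd.
have nac : ~~ e a c by apply/negP => ac'; exact: (noK4 simple_e srg_e xa xb xc ab bc ac').
have tri v w : g u v -> g u w -> e (F v) (F w) -> g v w.
  by move=> uv uw vw; apply: (@triangle_lift v u w); rewrite // gC.
apply/negP => _; apply: (@no_three_corner a' c' u b' d'); rewrite /apart ?Fa ?Fc ?ac //.
- by apply: contraTneq xb => ub'; rewrite -Fb -ub' Fu eirr.
- by apply: contraTneq xd => ud'; rewrite -Fd -ud' Fu eirr.
- by apply: contraNneq bd => bd'; rewrite -Fb -Fd bd'.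
- by rewrite gC.
- by apply: tri; rewrite ?Fa ?Fb.
- by apply: tri; rewrite ?Fc ?Fb.
- by apply: tri; rewrite ?Fa ?Fd // eC.
- by apply: tri; rewrite ?Fc ?Fd // eC.
Qed.

End Cover.

(** * Colouring the common neighbours by the fibre over a third vertex *)

Section Search.
Set Implicit Arguments. Unset Strict Implicit. Unset Printing Implicit Defensive.

(** The edge vertices of the flags (0,0) on b = 0, (1,0) on b = a + 1 and (3,2) on b = 3a. *)
Definition apex i := nth 0 [:: 33; 50; 92] i.

Definition nbrs_table := Eval vm_compute in
  [seq [seq z <- iota 1 32 | table (apex i) z] | i <- iota 0 3].
Definition nbrs i := nth [::] nbrs_table i.

(** The edge vertex of a flag (p, l) is adjacent to the other points on the vertical line of p and
    the parallels of l, which form three incident pairs (the ties), and to the other points of l and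
    the other lines through p (free). *)
Definition ties_table := Eval vm_compute in
  [seq [seq [:: z; w] | z <- nbrs i, w <- [seq w <- nbrs i | (z < w) && table z w]] | i <- iota 0 3].

Definition free_table := Eval vm_compute in
  [seq [seq [seq z <- nbrs i | ((z < 17) == b) && ~~ has (table z) (nbrs i)] | b <- [:: true; false]] | i <- iota 0 3].
Definition free_point i k := nth 0 (nth [::] (nth [::] free_table i) 0) k.
Definition free_line i k := nth 0 (nth [::] (nth [::] free_table i) 1) k.

(* The free points are paired with the free lines by the permutation q. *)
Definition class i (q : seq nat) k :=
  if k < 3 then nth [::] (nth [::] ties_table i) k
  else [:: free_point i (k - 3); free_line i (nth 0 q (k - 3))].

Definition pairings := permutations (iota 0 3).

Lemma apex_nbrs : all (fun i => (33 <= apex i < 97) && (table 0 (apex i) == false) &&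
  (uniq (nbrs i) && (size (nbrs i) == 12)) &&
  all (fun z => (0 < z < 33) && table (apex i) z) (nbrs i) &&
  all (fun z => table (apex i) z ==> (z \in nbrs i)) (iota 0 33)) (iota 0 3).
Proof. by vm_compute. Qed.

Lemma tie_adjacent : all (fun i => all (fun k =>
  if class i [::] k is [:: z; w] then [&& z != w, z \in nbrs i, w \in nbrs i & table z w] else false) (iota 0 3)) (iota 0 3).
Proof. by vm_compute. Qed.

Lemma free_mem : all (fun i => all (fun k => [&& free_point i k \in nbrs i, free_line i k \in nbrs i,
   ~~ has (table (free_point i k)) (nbrs i) & free_point i k < 17 <= free_line i k]) (iota 0 3)) (iota 0 3).
Proof. by vm_compute. Qed.

Lemma free_inj : all (fun i => all (fun k => all (fun l => (k == l) ||
  (free_point i k != free_point i l) && (free_line i k != free_line i l)) (iota 0 3)) (iota 0 3)) (iota 0 3).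
Proof. by vm_compute. Qed.

(** A tied vertex already has its partner, and [colour_common] forbids a partner sharing a neighbour
    with [z] near [x], such as another free point. Only the free lines remain. *)
Lemma free_partner : all (fun i => all (fun k => let z := free_point i k in all (fun z' =>
  [|| z' == z, has (fun l => z' == free_line i l) (iota 0 3), has (table z') (nbrs i)
   | has (fun m => table m z && table m z') (iota 1 32)]) (nbrs i)) (iota 0 3)) (iota 0 3).
Proof. by vm_compute. Qed.

Lemma class_mem : all (fun i => all (fun q => all (fun k =>
  if class i q k is [:: z; w] then [&& z != w, z \in nbrs i & w \in nbrs i] else false)
  (iota 0 6)) pairings) (iota 0 3).
Proof. by vm_compute. Qed.

Lemma class_disjoint : all (fun i => all (fun q => all (fun k => all (fun l =>
  (k == l) || ~~ has (fun z => z \in class i q l) (class i q k)) (iota 0 6)) (iota 0 6)) pairings) (iota 0 3).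
Proof. by vm_compute. Qed.

Lemma class_cover : all (fun i => all (fun q => all (fun z =>
  has (fun k => z \in class i q k) (iota 0 6)) (nbrs i)) pairings) (iota 0 3).
Proof. by vm_compute. Qed.

Lemma apex_adjacent : all (fun i => all (fun j => (i == j) || table (apex i) (apex j)) (iota 0 3)) (iota 0 3).
Proof. by vm_compute. Qed.

Definition cornered z1 z2 z3 := has (fun d => [&& table d z1, table d z2 & table d z3]) (iota 0 97).

(* A lift of the 4-cycle yi, z, w, yj would have two opposite vertices with three
   common neighbours. *)
Definition open_square i j z w :=
  let y := apex i in let y' := apex j in
  [&& table z w, ~~ table y' z, ~~ table y w &
    [|| cornered y z w, cornered z w y', cornered w y' y | cornered y' y z]].

Definition open_table := Eval vm_compute in
  mkseq (fun i => mkseq (fun j =>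
    if i < j then [seq s <- [seq (z, w) | z <- nbrs i, w <- nbrs j] | open_square i j s.1 s.2] else [::]) 3) 3.
Definition open_squares i j := nth [::] (nth [::] open_table i) j.

Lemma open_squaresP : all (fun i => all (fun j =>
  all (fun s => open_square i j s.1 s.2) (open_squares i j)) (iota 0 3)) (iota 0 3).
Proof. by vm_compute. Qed.

(** Necessary conditions for an edge between the k-th vertex over one apex and the l-th over the
    other: a common neighbour of both apices lifts to a triangle, so it belongs to both classes or
    to neither, and no forbidden 4-cycle arises. *)
Definition compatible i j q q' k l :=
  let c := class i q k in let c' := class j q' l in
  [&& all (fun z => table (apex j) z ==> (z \in c')) c, all (fun w => table (apex i) w ==> (w \in c)) c' &
    ~~ has (fun s => (s.1 \in c) && (s.2 \in c')) (open_squares i j)].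

(** Entry k of [t] gives the neighbours of the k-th vertex over the first apex in the other two
    fibres. These two are adjacent to each other by the triangle axiom, which is the test against
    [M23]. *)
Definition lift_ok (M12 M13 M23 : seq (seq bool)) (t : seq (nat * nat)) :=
  let get (M : seq (seq bool)) k l := nth false (nth [::] M k) l in
  [&& uniq (unzip1 t), uniq (unzip2 t) &
    all (fun k => let: (l, m) := nth (0, 0) t k in [&& get M12 k l, get M13 k m & get M23 l m]) (iota 0 (size t))].

Definition pairs6 := [seq (l, m) | l <- iota 0 6, m <- iota 0 6].

Definition compat_matrix i j q q' := mkseq (fun k => mkseq (compatible i j q q' k) 6) 6.

Lemma no_lift : all (fun q1 => all (fun q2 =>
  let M12 := compat_matrix 0 1 q1 q2 in all (fun q3 =>
  let M13 := compat_matrix 0 2 q1 q3 in let M23 := compat_matrix 1 2 q2 q3 in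
  backtrack pairs6 (lift_ok M12 M13 M23) (fun _ => false) 6 [::]) pairings) pairings) pairings.
Proof. by vm_compute. Qed.

End Search.

Section Pairing.
Set Implicit Arguments. Unset Strict Implicit. Unset Printing Implicit Defensive.
Variables (A : eqType) (B : finType) (f : A -> B) (D : {set B}).

Lemma sum_count s : {in s, forall a, f a \in D} ->
  size s = \sum_(w in D) count (fun a => f a == w) s.
Proof.
elim: s => [|a s IHs] fD; first by rewrite big1.
rewrite /= big_split /= -IHs => [|b bs]; last by apply: fD; rewrite inE bs orbT.
have aD : f a \in D by apply: fD; rewrite inE eqxx.
rewrite (bigD1 (f a)) //= eqxx big1 // => w /andP[_ /negbTE wa].
by rewrite eq_sym wa.
Qed.

(** No value is taken three times and there are twice as many arguments as values, so every value is
    taken exactly twice. *)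
Lemma partner_ex s : uniq s -> {in s, forall a, f a \in D} ->
  (forall a b c, a \in s -> b \in s -> c \in s -> a != b -> a != c -> b != c ->
     f a = f b -> f a = f c -> False) ->
  size s = 2 * #|D| -> forall a, a \in s -> exists b, [/\ b \in s, b != a & f b = f a].
Proof.
move=> us fD no3 sz a a_s.
have [/hasP[b bs /andP[ba /eqP fba]]|/hasPn alone] := boolP (has (fun b => (b != a) && (f b == f a)) s).
  by exists b.
have le2 w : count (fun b => f b == w) s <= 2.
  rewrite -size_filter; have uf : uniq [seq b <- s | f b == w] by rewrite filter_uniq.
  have mf b : b \in [seq b <- s | f b == w] -> f b = w /\ b \in s.
    by rewrite mem_filter => /andP[/eqP].
  case: [seq b <- s | f b == w] uf mf => [|b1 [|b2 [|b3 r]]] //= + mf.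
  rewrite !inE !negb_or -!andbA => /and5P[b12 b13 _ b23 _].
  have [f1 s1] : f b1 = w /\ b1 \in s by apply: mf; rewrite !inE eqxx.
  have [f2 s2] : f b2 = w /\ b2 \in s by apply: mf; rewrite !inE eqxx orbT.
  have [f3 s3] : f b3 = w /\ b3 \in s by apply: mf; rewrite !inE eqxx !orbT.
  by case: (no3 b1 b2 b3); rewrite ?f1 ?f2 ?f3.
have le1 : count (fun b => f b == f a) s <= 1.
  rewrite (@eq_in_count _ _ (pred1 a)) ?count_uniq_mem ?leq_b1 // => b bs /=.
  have := alone b bs; rewrite negb_and negbK; case: eqVneq => [->|_ /negbTE //].
  by rewrite eqxx.
have aD := fD a a_s; have := sum_count fD; rewrite sz (bigD1 (f a)) //=.
have : \sum_(w in D | w != f a) count (fun b => f b == w) s <= \sum_(w in D | w != f a) 2.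
  by apply: leq_sum => w _.
have -> : \sum_(w in D | w != f a) 2 = #|[predD1 D & f a]| * 2.
  by rewrite sum_nat_const; congr (_ * 2); apply: eq_card => w; rewrite !inE andbC.
have := cardD1 (f a) D; rewrite aD; move: le1.
by move: (count _ _) (\sum_(w in D | _) _) => n1 n2; lia.
Qed.

End Pairing.

(** * Pairings and matchings arising from an actual cover *)

Section Final.
Set Implicit Arguments. Unset Strict Implicit. Unset Printing Implicit Defensive.
Variables (V W : finType) (e : rel V) (g : rel W) (F : W -> V).
Hypotheses (simple_e : simple_graph e) (srg_e : srg e 105 32 4 12).
Hypotheses (simple_g : simple_graph g) (dr_g : distance_regular g).
Hypothesis antipodal : antipodal_r_cover g e F 6.
Variables (lab : nat -> V) (u : W).
Hypothesis F_u : F u = lab 0.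
Hypothesis labE : forall i j, i < 97 -> j < 97 ->
  e (lab i) (lab j) = table i j /\ (lab i == lab j) = (i == j).

Let eC := e_sym simple_e.
Let gC := e_sym simple_g.

Let adjE i j : i < 97 -> j < 97 -> e (lab i) (lab j) = table i j.
Proof. by move=> i97 j97; have [] := labE i97 j97. Qed.

Let eqE i j : i < 97 -> j < 97 -> (lab i == lab j) = (i == j).
Proof. by move=> i97 j97; have [] := labE i97 j97. Qed.

Let uniq_lift p v w : g p v -> g p w -> F v = F w -> v = w.
Proof. exact: (lift_uniq antipodal). Qed.

Let tri p a b : g p a -> g a b -> e (F p) (F b) -> g p b.
Proof. exact: (triangle_lift simple_e antipodal). Qed.

Let lt97 z : 0 < z < 33 -> z < 97.
Proof. by case/andP => _ /leq_trans ->. Qed.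

Definition nb_over v b := odflt v [pick w | g v w && (F w == b)].

Lemma liftP v b : e (F v) b -> g v (nb_over v b) /\ F (nb_over v b) = b.
Proof.
move=> /(lift_ex simple_e antipodal)[w vw Fw]; rewrite /nb_over; case: pickP => [z /andP[-> /eqP] //|/(_ w)].
by rewrite vw Fw eqxx.
Qed.

Definition near z := nb_over u (lab z).
(** Sorts the common neighbours of [x] and [y] by the vertex over [y] to which their lifts next to
    [u] lead. *)
Definition colour y z := nb_over (near z) (lab y).

Lemma nearP z : 0 < z < 33 -> g u (near z) /\ F (near z) = lab z.
Proof.
move=> z33; apply: liftP; rewrite F_u adjE //; last by lia.
by rewrite tableE ?ltnS //; [rewrite /net_adj; case: z z33|lia].
Qed.

Lemma near_inj z z' : 0 < z < 33 -> 0 < z' < 33 -> near z = near z' -> z = z'.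
Proof.
move=> z33 z'33 eq_n; have [_ Fz] := nearP z33; have [_ Fz'] := nearP z'33.
by apply/eqP; rewrite -eqE ?Fz -?Fz ?eq_n ?Fz' //; lia.
Qed.

Lemma colourP y z : y < 97 -> 0 < z < 33 -> table y z -> g (near z) (colour y z) /\ F (colour y z) = lab y.
Proof.
move=> y97 z33 yz; apply: liftP; have [_ ->] := nearP z33.
by rewrite eC adjE //; lia.
Qed.

Lemma near_adj z z' : 0 < z < 33 -> 0 < z' < 33 -> table z z' -> g (near z) (near z').
Proof.
move=> z33 z'33 zz'; have [uz Fz] := nearP z33; have [uz' Fz'] := nearP z'33.
by apply: (@tri (near z) u); rewrite ?Fz ?Fz' ?adjE // 1?gC //; lia.
Qed.

Lemma colour_eq y z w : y < 97 -> 0 < z < 33 -> table y z -> g (near z) w -> F w = lab y -> colour y z = w.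
Proof.
move=> y97 z33 yz zw Fw; have [zc Fc] := colourP y97 z33 yz.
by apply: (uniq_lift zc zw); rewrite Fc.
Qed.

Lemma tie_colour y z z' : y < 97 -> 0 < z < 33 -> 0 < z' < 33 -> table y z -> table y z' -> table z z' ->
  colour y z = colour y z'.
Proof.
move=> y97 z33 z'33 yz yz' zz'; have [z'c Fc] := colourP y97 z'33 yz'.
apply: colour_eq => //; apply: (tri (near_adj z33 z'33 zz') z'c).
by have [_ ->] := nearP z33; rewrite Fc eC adjE //; lia.
Qed.

(** The common colour and [u] would be apart with three common neighbours. *)
Lemma colour3 y z1 z2 z3 : 33 <= y < 97 -> table 0 y = false ->
  0 < z1 < 33 -> 0 < z2 < 33 -> 0 < z3 < 33 -> table y z1 -> table y z2 -> table y z3 ->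
  z1 != z2 -> z1 != z3 -> z2 != z3 -> colour y z1 = colour y z2 -> colour y z1 = colour y z3 -> False.
Proof.
move=> y97 y0 r1 r2 r3 t1 t2 t3 n12 n13 n23 c12 c13; have y97' : y < 97 by lia.
have [[u1 _] [u2 _] [u3 _]] := And3 (nearP r1) (nearP r2) (nearP r3).
have [g1 F1] := colourP y97' r1 t1; have [g2 _] := colourP y97' r2 t2; have [g3 _] := colourP y97' r3 t3.
apply: (@no_three_corner _ _ _ _ _ simple_e srg_e simple_g dr_g antipodal u (colour y z1) (near z1) (near z2) (near z3)) => //.
- by rewrite /apart F_u F1 eqE // adjE // y0 andbT eq_sym -lt0n (leq_trans _ (proj1 (andP y97))).
- by apply: contraNneq n12 => /near_inj ->.
- by apply: contraNneq n13 => /near_inj ->.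
- by apply: contraNneq n23 => /near_inj ->.
- by rewrite c12.
- by rewrite c13.
Qed.

(** With equal colours, [near z] and [near z'] would have the three common neighbours [u], [near m]
    and that colour. *)
Lemma colour_common y z z' m : 33 <= y < 97 -> table 0 y = false ->
  0 < z < 33 -> 0 < z' < 33 -> 0 < m < 33 -> table y z -> table y z' ->
  z != z' -> table z z' = false -> table m z -> table m z' -> colour y z != colour y z'.
Proof.
move=> y97 y0 rz rz' rm yz yz' zz' nzz' mz mz'; apply/eqP => cc; have y97' : y < 97 by lia.
have [[uz Fz] [uz' Fz'] [um Fm]] := And3 (nearP rz) (nearP rz') (nearP rm).
have [zc Fc] := colourP y97' rz yz; have [z'c _] := colourP y97' rz' yz'.
apply: (@no_three_corner _ _ _ _ _ simple_e srg_e simple_g dr_g antipodal (near z) (near z') u (colour y z) (near m)) => //.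
- by rewrite /apart Fz Fz' eqE ?adjE ?nzz' ?zz' ?lt97.
- by apply/eqP => uc; have := eqE (i := 0) (j := y) isT y97'; rewrite -Fc -uc F_u eqxx => /esym/eqP y_0; rewrite -y_0 in y97.
- by apply/eqP => un; have := eqE (i := 0) (j := m) isT (lt97 rm); rewrite -Fm -un F_u eqxx => /esym/eqP m_0; rewrite -m_0 in rm.
- apply/eqP => cm; have := eqE (i := y) (j := m) y97' (lt97 rm); rewrite -Fm -cm Fc eqxx => /esym/eqP ym.
  by have := leq_trans (proj2 (andP rm)) (proj1 (andP y97)); rewrite ym ltnn.
- by rewrite gC.
- by rewrite cc gC.
- by rewrite gC near_adj.
- exact: near_adj.
Qed.

(** The lift of [d] next to [p1] is also next to [p0] and [p2], by two triangles; it is a third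
    common neighbour of these besides [p1] and [p3]. *)
Lemma no_open_square p0 p1 p2 p3 d : g p0 p1 -> g p1 p2 -> g p2 p3 -> g p3 p0 ->
  apart e F p0 p2 -> apart e F p1 p3 -> e d (F p0) -> e d (F p1) -> e d (F p2) -> False.
Proof.
move=> g01 g12 g23 g30 a02 a13 d0 d1 d2.
have [|g1d Fd] := @liftP p1 d; first by rewrite eC.
have [n13 e13] := andP a13.
apply: (@no_three_corner _ _ _ _ _ simple_e srg_e simple_g dr_g antipodal p0 p2 p1 p3 (nb_over p1 d)) => //.
- by apply: contraNneq n13 => ->.
- by apply: contraTneq d1 => p1d; rewrite -Fd -p1d (e_irr simple_e).
- by apply: contraNneq e13 => ->; rewrite Fd eC.
- by rewrite gC.
- by rewrite gC.
- by apply: (tri g01 g1d); rewrite Fd eC.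
- by rewrite gC; apply: (tri (etrans (gC p2 p1) g12) g1d); rewrite Fd eC.
Qed.

Lemma apexP i : i < 3 -> [/\ 33 <= apex i < 97, table 0 (apex i) = false, uniq (nbrs i), size (nbrs i) = 12 &
  forall z, (z \in nbrs i) = (0 < z < 33) && table (apex i) z].
Proof.
move=> i3; have /andP[/andP[/andP[/andP[y97 /eqP y0] /andP[un /eqP sz]] /allP all1] /allP all2] :=
  iota_allP apex_nbrs i3.
split=> // z; apply/idP/andP => [/all1/andP[]//|[/andP[_ z33] yz]].
by have := all2 z; rewrite mem_iota z33 => /(_ isT); rewrite yz.
Qed.

Lemma mem_pairings q : uniq q -> size q = 3 -> {in q, forall k, k < 3} -> q \in pairings.
Proof.
move=> uq sq q3; rewrite mem_permutations; apply: uniq_perm => //.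
have [||//] := uniq_min_size uq (s2 := iota 0 3); last by rewrite sq.
by move=> k /q3; rewrite mem_iota.
Qed.

Lemma table_irr z : z < 97 -> table z z = false.
Proof. by move=> z97; rewrite -adjE // (e_irr simple_e). Qed.

Lemma colour3_nbrs i z1 z2 z3 : i < 3 -> z1 \in nbrs i -> z2 \in nbrs i -> z3 \in nbrs i ->
  z1 != z2 -> z1 != z3 -> z2 != z3 ->
  colour (apex i) z1 = colour (apex i) z2 -> colour (apex i) z1 = colour (apex i) z3 -> False.
Proof.
move=> /apexP[y97 y0 _ _ nbrsE]; rewrite !nbrsE => /andP[r1 t1] /andP[r2 t2] /andP[r3 t3].
exact: colour3.
Qed.

Lemma tie_colour_nbrs i z w : i < 3 -> z \in nbrs i -> w \in nbrs i -> table z w ->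
  colour (apex i) z = colour (apex i) w.
Proof.
move=> /apexP[/andP[_ y97] _ _ _ nbrsE]; rewrite !nbrsE => /andP[r1 t1] /andP[r2 t2] zw.
exact: tie_colour.
Qed.

Lemma free_colour i k : i < 3 -> k < 3 -> exists2 l, l < 3 &
  colour (apex i) (free_point i k) = colour (apex i) (free_line i l).
Proof.
move=> i3 k3; have [y97 y0 un sz nbrsE] := apexP i3; have /andP[_ y97'] := y97.
have /and4P[zN _ zfree _] := iota_allP (iota_allP free_mem i3) k3.
set z := free_point i k in zN zfree *; set c := colour _.
have [b [bN bz cb]] : exists b, [/\ b \in nbrs i, b != z & c b = c z].
  apply: (@partner_ex _ _ c (fibre F (lab (apex i)))) => //.
  - by move=> a; rewrite nbrsE => /andP[ra ya]; have [_ Fa] := colourP y97' ra ya; rewrite inE Fa.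
  - by move=> a1 a2 a3; exact: colour3_nbrs.
  - by rewrite sz (fibre_card antipodal).
have zb : table z b = false by apply/negbTE; apply: contra zfree => zb; apply/hasP; exists b.
have := allP (iota_allP (iota_allP free_partner i3) k3) b bN; rewrite -/z (negbTE bz).
move: (zN) (bN); rewrite !nbrsE => /andP[rz yz] /andP[rb yb].
case/or4P => [//|/hasP[l]|/hasP[v vN bv]|/hasP[m]].
- by rewrite mem_iota => l3 /eqP bl; exists l; rewrite // -bl cb.
- case: (@colour3_nbrs i z b v) => //.
  + by rewrite eq_sym.
  + by apply: contraTneq bv => <-; rewrite tableC ?lt97 // zb.
  + by apply: contraTneq bv => <-; rewrite table_irr ?lt97.
  + by rewrite -(tie_colour_nbrs i3 bN vN bv).
- rewrite mem_iota => rm /andP[mz mb]; have zb' : z != b by rewrite eq_sym.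
  by have := colour_common y97 y0 rz rb rm yz yb zb' zb mz mb; rewrite -/c cb eqxx.
Qed.

(** [q] sends each free point to the free line of its colour, injectively because three vertices
    never share a colour. Every class then exhausts its colour, so distinct classes have distinct
    colours. *)
Lemma colouring i : i < 3 -> exists2 q, q \in pairings & forall k l z w, k < 6 -> l < 6 ->
  z \in class i q k -> w \in class i q l -> (colour (apex i) z == colour (apex i) w) = (k == l).
Proof.
move=> i3; set c := colour _.
have [q0 q03 c0] := free_colour (k := 0) i3 isT; have [q1 q13 c1] := free_colour (k := 1) i3 isT.
have [q2 q23 c2] := free_colour (k := 2) i3 isT.
pose q := [:: q0; q1; q2].
have cq k : k < 3 -> nth 0 q k < 3 /\ c (free_point i k) = c (free_line i (nth 0 q k)).
  by case: k => [|[|[|]]].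
have q_inj k l : k < 3 -> l < 3 -> k != l -> nth 0 q k != nth 0 q l.
  move=> k3 l3 kl; apply/eqP => qq; have [qk3 ck] := cq k k3; have [_ cl] := cq l l3.
  have /and4P[kN _ _ /andP[k17 _]] := iota_allP (iota_allP free_mem i3) k3.
  have /and4P[lN _ _ /andP[l17 _]] := iota_allP (iota_allP free_mem i3) l3.
  have /and4P[_ qN _ /andP[_ q17]] := iota_allP (iota_allP free_mem i3) qk3.
  have := iota_allP (iota_allP (iota_allP free_inj i3) k3) l3; rewrite (negbTE kl) => /andP[kl' _].
  apply: (@colour3_nbrs i (free_point i k) (free_point i l) (free_line i (nth 0 q k))) => //.
  - by apply: contraTneq k17 => ->; rewrite ltnNge q17.
  - by apply: contraTneq l17 => ->; rewrite ltnNge q17.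
  - by rewrite -/c ck cl qq.
have qP : q \in pairings.
  apply: mem_pairings => //; last by move=> k; rewrite !inE => /or3P[]/eqP ->.
  by rewrite /= !inE negb_or (q_inj 0 1) ?(q_inj 0 2) ?(q_inj 1 2).
exists q => // k l z w k6 l6 zk wl.
have same j a b : j < 6 -> a \in class i q j -> b \in class i q j -> c a = c b.
  move=> j6; case: (ltnP j 3) => j3.
    have := iota_allP (iota_allP tie_adjacent i3) j3; rewrite /class j3.
    case: (nth _ _ _) => [|z1 [|z2 []]] // /and4P[_ z1N z2N z12].
    have c12 : c z1 = c z2 by exact: tie_colour_nbrs.
    by rewrite !inE => /orP[]/eqP -> /orP[]/eqP ->.
  have [|_ cj] := cq (j - 3); first by rewrite ltn_subLR.
  by rewrite /class ltnNge j3 /= !inE => /orP[]/eqP -> /orP[]/eqP ->.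
have [kl|kl] := eqVneq k l; first by apply/eqP/(same l); rewrite // -kl.
apply/eqP => czw.
have := iota_allP (allP (iota_allP class_mem i3) q qP) k6.
have disj := iota_allP (iota_allP (allP (iota_allP class_disjoint i3) q qP) k6) l6.
rewrite (negbTE kl) /= in disj; have dis a : a \in class i q k -> a != w.
  by move=> ak; apply: contraNneq disj => aw; apply/hasP; exists a; rewrite // aw.
have wN : w \in nbrs i.
  have := iota_allP (allP (iota_allP class_mem i3) q qP) l6; move: wl.
  by case: (class i q l) => [|z1 [|z2 []]] //; rewrite !inE => /orP[]/eqP -> /and3P[].
move: (same k) zk dis; case: (class i q k) => [|z1 [|z2 []]] // samek zk dis /and3P[z12 z1N z2N].
have m1 : z1 \in [:: z1; z2] by rewrite !inE eqxx.
have m2 : z2 \in [:: z1; z2] by rewrite !inE eqxx orbT.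
apply: (@colour3_nbrs i z1 z2 w) => //; [exact: dis|exact: dis|exact: samek|].
by rewrite -/c (samek z1 z).
Qed.

Definition proper i q := q \in pairings /\ forall k l z w, k < 6 -> l < 6 ->
  z \in class i q k -> w \in class i q l -> (colour (apex i) z == colour (apex i) w) = (k == l).

Definition shade i q k := colour (apex i) (head 0 (class i q k)).

Lemma class_nbrs i q k z : i < 3 -> q \in pairings -> k < 6 -> z \in class i q k -> z \in nbrs i.
Proof.
move=> i3 qP k6; have := iota_allP (allP (iota_allP class_mem i3) q qP) k6.
by case: (class i q k) => [|z1 [|z2 []]] // /and3P[_ z1N z2N]; rewrite !inE => /orP[]/eqP ->.
Qed.

Lemma head_class i q k : i < 3 -> q \in pairings -> k < 6 -> head 0 (class i q k) \in class i q k.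
Proof.
move=> i3 qP k6; have := iota_allP (allP (iota_allP class_mem i3) q qP) k6.
by case: (class i q k) => [|z1 r] //= _; rewrite inE eqxx.
Qed.

Lemma shade_eq i q k l z : i < 3 -> proper i q -> k < 6 -> l < 6 -> z \in class i q k ->
  (colour (apex i) z == shade i q l) = (k == l).
Proof. by move=> i3 [qP pr] k6 l6 zk; apply: pr => //; apply: head_class. Qed.

Lemma shade_inj i q k l : i < 3 -> proper i q -> k < 6 -> l < 6 -> shade i q k = shade i q l -> k = l.
Proof.
move=> i3 pr k6 l6 kl; apply/eqP; rewrite -(shade_eq i3 pr k6 l6 (z := head 0 (class i q k))).
  by rewrite -/(shade i q k) kl.
by case: pr => qP _; apply: head_class.
Qed.

Lemma F_shade i q k : i < 3 -> proper i q -> k < 6 -> F (shade i q k) = lab (apex i).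
Proof.
move=> i3 [qP _] k6; have [/andP[_ y97] _ _ _ nbrsE] := apexP i3.
have := class_nbrs i3 qP k6 (head_class i3 qP k6); rewrite nbrsE => /andP[rz yz].
by have [] := colourP y97 rz yz.
Qed.

Lemma shade_onto i q w : i < 3 -> proper i q -> F w = lab (apex i) -> exists2 k, k < 6 & shade i q k = w.
Proof.
move=> i3 pr Fw; pose S := [set shade i q (k : 'I_6) | k : 'I_6].
have cS : #|S| = 6.
  rewrite card_imset ?card_ord // => k l kl.
  by apply/val_inj/(shade_inj i3 pr (ltn_ord k) (ltn_ord l)).
have sub : S \subset fibre F (lab (apex i)).
  by apply/subsetP => _ /imsetP[k _ ->]; rewrite inE (F_shade i3 pr (ltn_ord k)).
have /eqP SE : S == fibre F (lab (apex i)) by rewrite eqEcard sub (fibre_card antipodal) cS.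
have : w \in S by rewrite SE inE Fw.
by case/imsetP => k _ ->; exists k.
Qed.

Lemma near_shade i q k z : i < 3 -> proper i q -> k < 6 -> z \in class i q k -> g (near z) (shade i q k).
Proof.
move=> i3 pr k6 zk; have /eqP <- : colour (apex i) z == shade i q k by rewrite (@shade_eq i q k k).
have [/andP[_ y97] _ _ _ nbrsE] := apexP i3; have [qP _] := pr.
have := class_nbrs i3 qP k6 zk; rewrite nbrsE => /andP[rz yz].
by have [] := colourP y97 rz yz.
Qed.

(** The path [near z], [shade i q k], [shade j q' l] lies over a triangle, so its ends are adjacent
    and the second one is the colour of [z] at apex [j]. *)
Lemma class_transfer i j q q' k l z : i < 3 -> j < 3 -> i != j -> proper i q -> proper j q' -> k < 6 -> l < 6 ->
  g (shade i q k) (shade j q' l) -> z \in class i q k -> table (apex j) z -> z \in class j q' l.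
Proof.
move=> i3 j3 ij pr pr' k6 l6 kl zk yz; have [/andP[_ y97] _ _ _ nbrsE] := apexP j3.
have [[qP _] [qP' _]] := (pr, pr').
have := class_nbrs i3 qP k6 zk; have [_ _ _ _ ->] := apexP i3; case/andP => rz _.
have zN : z \in nbrs j by rewrite nbrsE rz.
have /hasP[m] := allP (allP (iota_allP class_cover j3) q' qP') z zN.
rewrite mem_iota => m6 zm; have := shade_eq j3 pr' m6 l6 zm.
suff -> : colour (apex j) z = shade j q' l by rewrite eqxx => /esym/eqP <-.
apply: colour_eq => //; last exact: F_shade.
apply: (tri (near_shade i3 pr k6 zk) kl).
by have [_ ->] := nearP rz; rewrite (F_shade j3 pr' l6) eC adjE // lt97.
Qed.

Lemma closed_square i j q q' k l z w : i < 3 -> j < 3 -> i != j -> proper i q -> proper j q' -> k < 6 -> l < 6 ->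
  g (shade i q k) (shade j q' l) -> z \in class i q k -> w \in class j q' l -> open_square i j z w -> False.
Proof.
move=> i3 j3 ij pr pr' k6 l6 kl zk wl /and4P[zw jz iw corner].
have [/andP[iy97 iy] _ _ _ iN] := apexP i3; have [/andP[jy97 jy] _ _ _ jN] := apexP j3.
have [[qP _] [qP' _]] := (pr, pr').
have := class_nbrs i3 qP k6 zk; rewrite iN => /andP[rz iz].
have := class_nbrs j3 qP' l6 wl; rewrite jN => /andP[rw jw].
have zw' := near_adj rz rw zw; have iz' := near_shade i3 pr k6 zk; have jw' := near_shade j3 pr' l6 wl.
have [[_ Fz] [_ Fw]] := (nearP rz, nearP rw).
have [Fi Fj] := (F_shade i3 pr k6, F_shade j3 pr' l6).
have lz97 := lt97 rz; have lw97 := lt97 rw.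
have ap1 : apart e F (shade i q k) (near w).
  rewrite /apart Fi Fw eqE // adjE // iw andbT; apply: contraTneq iy97 => ->.
  by rewrite -ltnNge; case/andP: rw.
have ap1' : apart e F (near w) (shade i q k) by rewrite /apart eq_sym eC.
have ap2 : apart e F (near z) (shade j q' l).
  rewrite /apart Fj Fz eqE // adjE // tableC // jz andbT eq_sym; apply: contraTneq jy97 => ->.
  by rewrite -ltnNge; case/andP: rz.
have ap2' : apart e F (shade j q' l) (near z) by rewrite /apart eq_sym eC.
have lab_adj d v y : d < 97 -> y < 97 -> F v = lab y -> table d y -> e (lab d) (F v).
  by move=> d97 y97 -> dy; rewrite adjE.
have [zi wz ki lw] : [/\ g (shade i q k) (near z), g (near w) (near z), g (shade j q' l) (shade i q k) & g (near w) (shade j q' l)].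
  by split; rewrite // gC.
case/or4P: corner => /hasP[d]; rewrite mem_iota => d97 /and3P[d1 d2 d3].
- apply: (@no_open_square (shade i q k) (near z) (near w) (shade j q' l) (lab d)) => //;
    first [exact: (lab_adj _ _ _ d97 iy)|exact: (lab_adj _ _ _ d97 lz97)|exact: (lab_adj _ _ _ d97 lw97)].
- apply: (@no_open_square (near z) (near w) (shade j q' l) (shade i q k) (lab d)) => //;
    first [exact: (lab_adj _ _ _ d97 jy)|exact: (lab_adj _ _ _ d97 lz97)|exact: (lab_adj _ _ _ d97 lw97)|by rewrite gC].
- apply: (@no_open_square (near w) (shade j q' l) (shade i q k) (near z) (lab d)) => //;
    first [exact: (lab_adj _ _ _ d97 jy)|exact: (lab_adj _ _ _ d97 iy)|exact: (lab_adj _ _ _ d97 lw97)].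
apply: (@no_open_square (shade j q' l) (shade i q k) (near z) (near w) (lab d)) => //;
  first [exact: (lab_adj _ _ _ d97 jy)|exact: (lab_adj _ _ _ d97 iy)|exact: (lab_adj _ _ _ d97 lz97)].
Qed.

Lemma shade_compatible i j q q' k l : i < 3 -> j < 3 -> i != j -> proper i q -> proper j q' -> k < 6 -> l < 6 ->
  g (shade i q k) (shade j q' l) -> compatible i j q q' k l.
Proof.
move=> i3 j3 ij pr pr' k6 l6 kl; apply/and3P; split.
- by apply/allP => z zk; apply/implyP => jz; exact: (class_transfer i3 j3 ij pr pr' k6 l6 kl zk jz).
- apply/allP => w wl; apply/implyP => iw; rewrite gC in kl; rewrite eq_sym in ij.
  exact: (class_transfer j3 i3 ij pr' pr l6 k6 kl wl iw).
apply/hasPn => s sO; apply/negP => /andP[zk wl].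
have := allP (iota_allP (iota_allP open_squaresP i3) j3) s sO.
exact: (closed_square i3 j3 ij pr pr' k6 l6 kl zk wl).
Qed.

Lemma shade_match i j q q' k : i < 3 -> j < 3 -> i != j -> proper i q -> proper j q' -> k < 6 ->
  exists2 l, l < 6 & g (shade i q k) (shade j q' l).
Proof.
move=> i3 j3 ij pr pr' k6.
have [/andP[_ y97] _ _ _ _] := apexP i3; have [/andP[_ y97'] _ _ _ _] := apexP j3.
have yy : e (F (shade i q k)) (lab (apex j)).
  rewrite (F_shade i3 pr k6) adjE //.
  by have := iota_allP (iota_allP apex_adjacent i3) j3; rewrite (negbTE ij).
have [kw Fw] := liftP yy; have [l l6 lE] := shade_onto j3 pr' Fw.
by exists l; rewrite ?lE.
Qed.

Lemma no_cover_labelling : False.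
Proof.
have [q1 q1P pr1'] := colouring (i := 0) isT; have pr1 : proper 0 q1 by [].
have [q2 q2P pr2'] := colouring (i := 1) isT; have pr2 : proper 1 q2 by [].
have [q3 q3P pr3'] := colouring (i := 2) isT; have pr3 : proper 2 q3 by [].
pose match_of i j q q' k := find (fun l => g (shade i q k) (shade j q' l)) (iota 0 6).
have matchP i j q q' k : i < 3 -> j < 3 -> i != j -> proper i q -> proper j q' -> k < 6 ->
    match_of i j q q' k < 6 /\ g (shade i q k) (shade j q' (match_of i j q q' k)).
  move=> i3 j3 ij pr pr' k6; have [l l6 kl] := shade_match i3 j3 ij pr pr' k6.
  have has_l : has (fun l => g (shade i q k) (shade j q' l)) (iota 0 6).
    by apply/hasP; exists l; rewrite ?mem_iota.
  have m6 : match_of i j q q' k < 6 by move: has_l; rewrite has_find size_iota.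
  by split=> //; have := nth_find 0 has_l; rewrite nth_iota.
have match_inj i j q q' k l : i < 3 -> j < 3 -> i != j -> proper i q -> proper j q' -> k < 6 -> l < 6 ->
    match_of i j q q' k = match_of i j q q' l -> k = l.
  move=> i3 j3 ij pr pr' k6 l6 kl; have [m6 mk] := matchP i j q q' k i3 j3 ij pr pr' k6.
  have [_ ml] := matchP i j q q' l i3 j3 ij pr pr' l6; rewrite -kl in ml.
  apply: (shade_inj i3 pr k6 l6); rewrite gC in mk; rewrite gC in ml.
  by apply: (uniq_lift mk ml); rewrite !F_shade.
pose p := match_of 0 1 q1 q2; pose r := match_of 0 2 q1 q3.
pose s := mkseq (fun k => (p k, r k)) 6.
have /allP bt := allP (allP no_lift q1 q1P) q2 q2P.
suff : false by [].
apply: (backtrackP (s := s) (bt q3 q3P)).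
  move=> _ /mapP[k + ->]; rewrite mem_iota => k6.
  have [p6 _] := matchP 0 1 q1 q2 k isT isT isT pr1 pr2 k6.
  have [r6 _] := matchP 0 2 q1 q3 k isT isT isT pr1 pr3 k6.
  by apply: allpairs_f; rewrite mem_iota.
move=> i; have -> : take i s = mkseq (fun k => (p k, r k)) (minn i 6) by rewrite -map_take take_iota.
have : minn i 6 <= 6 by rewrite geq_minr.
move: (minn i 6) => n n6; have lt6 k : k \in iota 0 n -> k < 6.
  by rewrite mem_iota => /andP[_ /leq_trans]; apply.
apply/and3P; split.
- rewrite /unzip1 -map_comp map_inj_in_uniq ?iota_uniq // => k l /lt6 k6 /lt6 l6 /=.
  exact: (match_inj 0 1 q1 q2).
- rewrite /unzip2 -map_comp map_inj_in_uniq ?iota_uniq // => k l /lt6 k6 /lt6 l6 /=.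
  exact: (match_inj 0 2 q1 q3).
apply/allP => k; rewrite size_mkseq => kn; have k6 := lt6 k kn.
rewrite nth_mkseq; last by move: kn; rewrite mem_iota.
have [p6 kp] := matchP 0 1 q1 q2 k isT isT isT pr1 pr2 k6.
have [r6 kr] := matchP 0 2 q1 q3 k isT isT isT pr1 pr3 k6.
rewrite /compat_matrix !nth_mkseq //; apply/and3P; split; apply: shade_compatible => //.
(* The third matching is read off the triangle through [shade 0 q1 k]. *)
rewrite gC in kp; by apply: (tri kp kr); rewrite !F_shade // adjE.
Qed.

End Final.

Theorem theorem4p9 (T1 : finType) (eD : rel T1) (T2 : finType) (eH : rel T2) (thH : T2 -> T1) :
  simple_graph eD -> srg eD 105 32 4 12 ->
  simple_graph eH -> distance_regular eH -> r_cover eH eD thH 3 ->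
  ~ (exists (T3 : finType) (eG : rel T3) (th : T3 -> T2),
       simple_graph eG /\ r_cover eG eH th 2 /\
       distance_regular eG /\ antipodal_r_cover eG eD (fun x => thH (th x)) 6).
Proof.
move=> simple_e srg_e _ _ _ [T3 [eG [th [simple_g [_ [dr_g antipodal]]]]]].
have [x _] : exists x : T1, x \in [set: T1].
  by apply/set0Pn; rewrite -card_gt0 cardsT; have [-> _] := srg_e.
have wheel := cover_wheel simple_e srg_e simple_g dr_g antipodal (x := x).
have [lab [lab0 labE]] := labelling simple_e srg_e wheel.
have [[[surj _] _] _] := antipodal; have [u Fu] := surj x; rewrite -lab0 in Fu.
exact: (no_cover_labelling simple_e srg_e simple_g dr_g antipodal Fu labE).
Qed.
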